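(* Let $u,m\ge 2$ be integers, $n=u+m$, and let $Z$ be uniform over the $u$-element subsets of $[n]$, $\bar Z=[n]\setminus Z$. Let $(\mathbf x_i,y_i)_{i=1}^n$ be a fixed full sample in $\mathcal X\times\mathcal Y$, let $\mathcal F$ be a nonempty class of functions $\mathcal X\to\mathbb R$, and let $\ell:\mathbb R\times\mathcal Y\to\mathbb R$ be a loss with $0\le\ell_f(i)\le L_0$ for all $f\in\mathcal F$, $i\in[n]$, where $L_0>0$. Suppose: (1) there is $f_n^*\in\mathcal F$ with $\mathcal L_n(\ell_{f_n^*})=\inf_{f\in\mathcal F}\mathcal L_n(\ell_f)$; (2) there is a constant $B>0$ with $T_n(h)\le B\,\mathcal L_n(h)$ for every $h\in\Delta^*_{\mathcal F}=\{\ell_f-\ell_{f_n^*}:f\in\mathcal F\}$; (3) for every split $Z$ the minima of $f\mapsto\mathcal L_m(\ell_f)$ and $f\mapsto\mathcal L_u(\ell_f)$ over $\mathcal F$ are attained, and $\hat f_m\in\arg\min_{f\in\mathcal F}\mathcal L_m(\ell_f)$, $\hat f_u\in\arg\min_{f\in\mathcal F}\mathcal L_u(\ell_f)$ are (measurable) selections. Fix $K_0>1$. Let $\psi_{u,m}$ be a sub-root function with positive fixed point $r_{u,m}$ such that, for every $r\ge r_{u,m}$, $$\psi_{u,m}(r)\ge\max_{p\in\{u,m\},\,\eta\in\{+,-\}}\max\{\mathfrak R_p^\eta(\mathcal H(r)),\mathfrak R_p^\eta(\mathcal H^2(r))\},$$ where $\mathcal H(r)=\{h\in\Delta_{\mathcal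 F}:\tilde T_n(h)\le r\}\cup\{0\}$ and $\mathcal H^2(r)=\{h^2:h\in\Delta_{\mathcal F},\tilde T_n(h)\le r\}\cup\{0\}$. Let $\psi^*_{u,m}$ be a sub-root function with positive fixed point $r^*$ such that, for every $r\ge r^*$, $$\psi^*_{u,m}(r)\ge\max_{p\in\{u,m\},\,\eta\in\{+,-\}}\max\{\mathfrak R_p^\eta(\mathcal F_r^* ),\mathfrak R_p^\eta((\mathcal F_r^* )^2)\},$$ where $\mathcal F_r^*=\{h\in\Delta^*_{\mathcal F}:B\mathcal L_n(h)\le r\}\cup\{0\}$ and $(\mathcal F_r^* )^2=\{h^2:h\in\Delta^*_{\mathcal F},B\mathcal L_n(h)\le r\}\cup\{0\}$. Set $c_0=\sqrt{219}$, $d_0=4+4c_0/7$, $c_1=8K_0d_0^2$, $c_2=8K_0c_0^2+32L_0+c_0$. There is a positive constant $c_\Delta$ depending only on $B$ and $L_0$ such that, with $c_3=c_2+4Bc_\Delta/K_0$, for every $x>0$, with probability at least $1-3\exp(-x)$ over $Z$, $$\mathcal E(\hat f_m)\le c_1r_{u,m}+\frac{4Bc_\Delta r^*}{K_0}+\frac{c_3x}{N_{u,m}}.$$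
   Context: $[n]=\{1,\dots,n\}$, $N_{u,m}=\min\{u,m\}$, $\mathcal X\subseteq\mathbb R^d$, $\mathcal Y\subseteq\mathbb R$. For $f\in\mathcal F$, $\ell_f(i)=\ell(f(\mathbf x_i),y_i)$, $i\in[n]$. For $h:[n]\to\mathbb R$ and nonempty $\mathcal A\subseteq[n]$, $\mathcal L_h(\mathcal A)=|\mathcal A|^{-1}\sum_{i\in\mathcal A}h(i)$; $\mathcal L_n(h)=\mathcal L_h([n])$, $\mathcal L_m(h)=\mathcal L_h(\bar Z)$ (training average), $\mathcal L_u(h)=\mathcal L_h(Z)$ (test average), $T_n(h)=n^{-1}\sum_{i=1}^nh(i)^2$. The excess risk is $\mathcal E(f)=\mathcal L_u(\ell_f)-\mathcal L_u(\ell_{\hat f_u})$. $\Delta_{\mathcal F}=\{\ell_{f_1}-\ell_{f_2}:f_1,f_2\in\mathcal F\}$ (functions on $[n]$). With $g_f=\ell_f-\ell_{f_n^*}$, the surrogate functional on $\Delta_{\mathcal F}$ is $$\tilde T_n(h)=\inf\{2B(\mathcal L_n(g_{f_1})+\mathcal L_n(g_{f_2})):f_1,f_2\in\mathcal F,\ \ell_{f_1}-\ell_{f_2}=h\}.$$ For a nonempty class $\mathcal A$ of functions on $[n]$, $\mathfrak R_u^{\pm}(\mathcal A)=\mathbb E[\sup_{h\in\mathcal A}\pm(\mathcal L_h(Z)-\mathcal L_n(h))]$ and $\mathfrak R_m^{\pm}(\mathcal A)=\mathbb E[\sup_{h\in\mathcal A}\pm(\mathcal L_h(\bar Z)-\mathcal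 L_n(h))]$, expectations over $Z$. A function $\psi:[0,\infty)\to[0,\infty)$ is sub-root if it is nonnegative, nondecreasing, and $r\mapsto\psi(r)/\sqrt r$ is nonincreasing on $(0,\infty)$; a fixed point is a positive $r^*$ with $\psi(r^* )=r^*$. ''Depending only on $B$ and $L_0$'' means $c_\Delta$ is a function of $B,L_0$ alone, the same for all $n,u,m,K_0,x$, samples, losses, classes and sub-root functions. *)

(* Defs.v *)
From HB Require Import structures.
From mathcomp Require Import all_boot all_order all_algebra.
From mathcomp Require Import all_classical all_reals all_analysis.

Set Implicit Arguments.
Unset Strict Implicit.
Unset Printing Implicit Defensive.

Import Order.TTheory GRing.Theory Num.Theory.

Local Open Scope ring_scope.

(* The index set {1, ..., n} is 'I_n. The sample space of a split is the finite
   set of all u-element subsets Z of 'I_n with the uniform law, so every event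
   and every selection Z |-> f_Z is measurable, and expectations are finite
   averages. *)
Definition splits (n u : nat) : {set {set 'I_n}} :=
  [set Z : {set 'I_n} | #|Z| == u].

Definition split_prob (R : realType) (n u : nat) (E : pred {set 'I_n}) : R :=
  #|[set Z in splits n u | E Z]|%:R / #|splits n u|%:R.

Definition split_esp (R : realType) (n u : nat) (G : {set 'I_n} -> R) : R :=
  (\sum_(Z in splits n u) G Z) / #|splits n u|%:R.

(* L_h(A); only used for nonempty A. *)
Definition avg (R : realType) (n : nat) (h : 'I_n -> R) (A : {set 'I_n}) : R :=
  (\sum_(i in A) h i) / #|A|%:R.

Definition avg_full (R : realType) (n : nat) (h : 'I_n -> R) : R :=
  avg h [set: 'I_n]%SET.

Definition second_moment (R : realType) (n : nat) (h : 'I_n -> R) : R :=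
  n%:R^-1 * \sum_(i < n) h i ^+ 2.

Local Open Scope classical_set_scope.

(* R_u^{+/-}(A) and R_m^{+/-}(A), where Z has u elements; the sign is
   (-1) ^+ eta, i.e. + for eta = false and - for eta = true.
   The real-valued sup is 0 on sets that are empty or not bounded above; it is
   only applied to nonempty classes of uniformly bounded functions. *)
Definition complexity_test (R : realType) (n u : nat) (eta : bool)
    (A : set ('I_n -> R)) : R :=
  split_esp u (fun Z => sup [set (-1) ^+ eta * (avg h Z - avg_full h) | h in A]).

Definition complexity_train (R : realType) (n u : nat) (eta : bool)
    (A : set ('I_n -> R)) : R :=
  split_esp u
    (fun Z => sup [set (-1) ^+ eta * (avg h (~: Z)%SET - avg_full h) | h in A]).

(* The maximum over p in {u, m} and eta in {+, -} of
   max (R_p^eta(A1)) (R_p^eta(A2)). *)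
Definition max_complexity (R : realType) (n u : nat)
    (A1 A2 : set ('I_n -> R)) : R :=
  let cu eta :=
    Num.max (complexity_test u eta A1) (complexity_test u eta A2) in
  let cm eta :=
    Num.max (complexity_train u eta A1) (complexity_train u eta A2) in
  Num.max (Num.max (cu false) (cu true)) (Num.max (cm false) (cm true)).

(* A function [0, oo) -> [0, oo) is encoded as a function on R of which only
   the values on [0, oo) matter. *)
Definition sub_root (R : realType) (psi : R -> R) : Prop :=
  [/\ forall r, 0 <= r -> 0 <= psi r,
      forall r s, 0 <= r -> r <= s -> psi r <= psi s
    & forall r s, 0 < r -> r <= s ->
        psi s / Num.sqrt s <= psi r / Num.sqrt r].

Definition pos_fixed_point (R : realType) (psi : R -> R) (r : R) : Prop :=
  0 < r /\ psi r = r.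

Definition argmin (R : realType) (T : Type) (F : set T) (J : T -> R) : set T :=
  [set f | F f /\ forall g, F g -> J f <= J g].

Definition adjoin0_squares (R : realType) (n : nat)
    (A : set ('I_n -> R)) : set ('I_n -> R) :=
  [set (fun i => h i ^+ 2) | h in A] `|` [set (fun=> 0)].

Definition adjoin0 (R : realType) (n : nat)
    (A : set ('I_n -> R)) : set ('I_n -> R) :=
  A `|` [set (fun=> 0)].

(* Below, TX and TY are the types of inputs and outputs, x and y the full
   sample, and fs stands for f_n^*. *)
Definition sample_loss (R : realType) (TX TY : Type) (n : nat)
    (loss : R -> TY -> R) (x : 'I_n -> TX) (y : 'I_n -> TY)
    (f : TX -> R) : 'I_n -> R :=
  fun i => loss (f (x i)) (y i).

Definition excess_loss (R : realType) (TX TY : Type) (n : nat)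
    (loss : R -> TY -> R) (x : 'I_n -> TX) (y : 'I_n -> TY)
    (fs f : TX -> R) : 'I_n -> R :=
  sample_loss loss x y f \- sample_loss loss x y fs.

Definition Delta (R : realType) (TX TY : Type) (n : nat)
    (loss : R -> TY -> R) (x : 'I_n -> TX) (y : 'I_n -> TY)
    (F : set (TX -> R)) : set ('I_n -> R) :=
  [set sample_loss loss x y f1 \- sample_loss loss x y f2 | f1 in F & f2 in F].

Definition Delta_star (R : realType) (TX TY : Type) (n : nat)
    (loss : R -> TY -> R) (x : 'I_n -> TX) (y : 'I_n -> TY)
    (F : set (TX -> R)) (fs : TX -> R) : set ('I_n -> R) :=
  [set excess_loss loss x y fs f | f in F].

(* The surrogate functional, meaningful for h in Delta: the infimum is then over
   a nonempty set, bounded below by 0 when fs minimizes the full average. *)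
Definition surrogate (R : realType) (TX TY : Type) (n : nat)
    (loss : R -> TY -> R) (x : 'I_n -> TX) (y : 'I_n -> TY)
    (F : set (TX -> R)) (fs : TX -> R) (B : R) (h : 'I_n -> R) : R :=
  inf [set t | exists f1 f2 : TX -> R,
    [/\ F f1, F f2, sample_loss loss x y f1 \- sample_loss loss x y f2 = h
      & t = 2 * B * (avg_full (excess_loss loss x y fs f1)
                     + avg_full (excess_loss loss x y fs f2))]].

Definition Delta_ball (R : realType) (TX TY : Type) (n : nat)
    (loss : R -> TY -> R) (x : 'I_n -> TX) (y : 'I_n -> TY)
    (F : set (TX -> R)) (fs : TX -> R) (B r : R) : set ('I_n -> R) :=
  [set h | Delta loss x y F h /\ surrogate loss x y F fs B h <= r].

Definition Delta_star_ball (R : realType) (TX TY : Type) (n : nat)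
    (loss : R -> TY -> R) (x : 'I_n -> TX) (y : 'I_n -> TY)
    (F : set (TX -> R)) (fs : TX -> R) (B r : R) : set ('I_n -> R) :=
  [set h | Delta_star loss x y F fs h /\ B * avg_full h <= r].

(* The excess risk E(f) on the test set Z, where fu minimizes the test risk. *)
Definition excess_risk (R : realType) (TX TY : Type) (n : nat)
    (loss : R -> TY -> R) (x : 'I_n -> TX) (y : 'I_n -> TY)
    (Z : {set 'I_n}) (fu f : TX -> R) : R :=
  avg (sample_loss loss x y f) Z - avg (sample_loss loss x y fu) Z.

Definition const_c0 (R : realType) : R := Num.sqrt 219.
Definition const_d0 (R : realType) : R := 4 + 4 * const_c0 R / 7.
Definition const_c1 (R : realType) (K0 : R) : R := 8 * K0 * const_d0 R ^+ 2.
Definition const_c2 (R : realType) (K0 L0 : R) : R :=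
  8 * K0 * const_c0 R ^+ 2 + 32 * L0 + const_c0 R.
Definition const_c3 (R : realType) (K0 L0 B cD : R) : R :=
  const_c2 K0 L0 + 4 * B * cD / K0.

(* Main.v *)
Require Import Defs.
From HB Require Import structures.
From mathcomp Require Import all_boot all_order all_algebra.
From mathcomp Require Import all_classical all_reals all_analysis.
From mathcomp Require Import ring lra zify.

Set Implicit Arguments.
Unset Strict Implicit.
Unset Printing Implicit Defensive.

Import Order.TTheory GRing.Theory Num.Theory.

Local Open Scope ring_scope.

(* Write g_f = l_f - l_{fs} and s = t / min(u, m).  It suffices to localize the
   empirical minimizers in Delta_star: with high probability the excess risk is at
   most C (rho + s) with C = C(B, L0), both for rho = r_star and for
   rho = 2 r_um, the latter because B L_n(g_f) <= r forces g_f into the ball of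
   radius 2 r of the surrogate.  The coefficient of r_um exceeds 2 K0 and that of
   r_star is 4 C^2 / K0 for c_Delta = C^2 / B, so the second choice of rho works
   when C <= K0 and the first one when K0 <= C.

   The minimizers form a finite family g_j indexed by the splits.  For such a
   family, let F(Z) be the supremum of |sum_Z (g - L_n(g))| + kappa sum_Z g^2.  The
   modified log-Sobolev inequality for the uniform law on the k-subsets, proved by
   induction on the ground set, gives
   Ent(e^{l F}) <= l^2 E[(a F + c) e^{l F}]: the penalty bounds the sum of squares of
   the maximizer by F / kappa.  Herbst's argument then yields
   F <= 2 E F + kappa N v + 2 a x outside an event of probability e^{-x}, where E F
   is controlled by the complexities of the class and of its squares.  Applied to
   the shells {B L_n <= 4^k r_0}, with kappa small and r_0 a large multiple of
   rho + s, this brings the minimizers down to the innermost shell.  The smaller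
   of Z and its complement carries the deviations of both averages. *)

(** * Slices of a finite set *)

(** The integrand of the Dirichlet form of [g] against [ln g], the right-hand side of the modified
    log-Sobolev inequality. *)
Definition logdist (R : realType) (x y : R) : R := (x - y) * (ln x - ln y).

Lemma logdist_sym (R : realType) (x y : R) : logdist x y = logdist y x.
Proof. by rewrite /logdist; ring. Qed.

Lemma logdistxx (R : realType) (x : R) : logdist x x = 0.
Proof. by rewrite /logdist subrr mul0r. Qed.

Lemma ln_leB1 (R : realType) (t : R) : 0 < t -> ln t <= t - 1.
Proof.
move=> t0; have -> : ln t = ln (1 + (t - 1)) by congr ln; ring.
by apply: le_ln1Dx; lra.
Qed.

Lemma logdistZ (R : realType) (k x y : R) :
  0 < k -> 0 < x -> 0 < y -> logdist (k * x) (k * y) = k * logdist x y.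
Proof.
by move=> k0 x0 y0; rewrite /logdist !lnM ?posrE //; ring.
Qed.

(** Comes from [ln q <= q - 1] at [q = (y / x) * (X / Y)]. When [X] and [Y] are the totals of the
    [x] and [y], the corrections cancel on summation and leave the log-sum inequality. *)
Lemma log_sum_tangent (R : realType) (x y X Y : R) :
  0 < x -> 0 < y -> 0 < X -> 0 < Y ->
  x * (ln X - ln Y) + x - y * (X / Y) <= x * (ln x - ln y).
Proof.
move=> x0 y0 X0 Y0.
have xV : 0 < x^-1 by rewrite invr_gt0.
have YV : 0 < Y^-1 by rewrite invr_gt0.
have yX : 0 < y * x^-1 by rewrite mulr_gt0.
have XY : 0 < X * Y^-1 by rewrite mulr_gt0.
have q0 : 0 < (y * x^-1) * (X * Y^-1) by rewrite mulr_gt0.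
have := ln_leB1 q0.
rewrite !lnM ?posrE // !lnV ?posrE // => H.
have := ler_wpM2l (ltW x0) H.
have -> : x * (y / x * (X / Y) - 1) = y * (X / Y) - x.
  by field; rewrite !gt_eqF.
by lra.
Qed.

(** The log-sum inequality, used once for [(x, y)] and once for [(y, x)]. *)
Lemma logdist_sum (R : realType) (I : finType) (P : pred I) (x y : I -> R) :
  (forall i, P i -> 0 < x i) -> (forall i, P i -> 0 < y i) ->
  logdist (\sum_(i | P i) x i) (\sum_(i | P i) y i)
    <= \sum_(i | P i) logdist (x i) (y i).
Proof.
move=> x0 y0; case: (pickP P) => [i0 Pi0|P0]; last first.
  by rewrite !big_pred0 // logdistxx.
set X := \sum_(i | P i) x i; set Y := \sum_(i | P i) y i.
have X0 : 0 < X.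
  rewrite /X (bigD1 i0) //= ltr_pwDl ?x0 // sumr_ge0 // => i /andP[Pi _].
  by rewrite ltW ?x0.
have Y0 : 0 < Y.
  rewrite /Y (bigD1 i0) //= ltr_pwDl ?y0 // sumr_ge0 // => i /andP[Pi _].
  by rewrite ltW ?y0.
apply: (@le_trans _ _ (\sum_(i | P i)
  ((x i * (ln X - ln Y) + x i - y i * (X / Y)) +
   (y i * (ln Y - ln X) + y i - x i * (Y / X))))).
  rewrite !(big_split, sumrN) /= -!mulr_suml -/X -/Y /logdist.
  rewrite le_eqVlt; apply/orP; left; apply/eqP.
  by field; rewrite !gt_eqF.
apply: ler_sum => i Pi.
have := log_sum_tangent (x0 _ Pi) (y0 _ Pi) X0 Y0.
have := log_sum_tangent (y0 _ Pi) (x0 _ Pi) Y0 X0.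
by rewrite /logdist; lra.
Qed.

(** * Double counting between neighbouring slices *)

Section Slice.
Variables (R : realType) (T : finType).
Implicit Types (V W Z : {set T}) (p : nat) (i j : T).

Definition slice V p : {set {set T}} := [set Z : {set T} | (Z \subset V) && (#|Z| == p)].

Lemma card_slice V p : #|slice V p| = 'C(#|V|, p).
Proof. exact: cards_draws. Qed.

Lemma sum_slice_notin V p i (phi : {set T} -> R) : i \in V ->
  \sum_(Z in slice V p | i \notin Z) phi Z = \sum_(Z in slice (V :\ i) p) phi Z.
Proof.
move=> iV; apply: eq_bigl => Z; rewrite !inE subsetD1.
by rewrite andbAC.
Qed.

Lemma sum_slice_in V p i (phi : {set T} -> R) : i \in V ->
  \sum_(Z in slice V p.+1 | i \in Z) phi Z
  = \sum_(W in slice (V :\ i) p) phi (i |: W).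
Proof.
move=> iV; rewrite (reindex_onto (fun W => i |: W) (fun Z => Z :\ i)) /=.
  apply: eq_bigl => W; rewrite !inE eqxx /= andbT subsetD1.
  rewrite finset.subUset finset.sub1set iV /= cardsU1.
  case: (boolP (i \in W)) => iW /=; last first.
    by rewrite finset.setU1K // eqxx !andbT add1n eqSS.
  rewrite andbF /= ; apply/negbTE/negP => /andP[_ /eqP E].
  by move: iW; rewrite -E !inE eqxx.
by move=> Z /andP[_ iZ]; rewrite finset.setD1K.
Qed.

Lemma sum_slice_split V p i (phi : {set T} -> R) : i \in V ->
  \sum_(Z in slice V p.+1) phi Z =
  \sum_(Z in slice (V :\ i) p.+1) phi Z
  + \sum_(W in slice (V :\ i) p) phi (i |: W).
Proof.
move=> iV; rewrite (bigID (fun Z => i \in Z)) /= sum_slice_in //.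
by rewrite sum_slice_notin // addrC.
Qed.

Lemma sum_slice_addl V p (phi : {set T} -> T -> R) :
  \sum_(i in V) \sum_(W in slice (V :\ i) p) phi (i |: W) i
  = \sum_(Z in slice V p.+1) \sum_(i in Z) phi Z i.
Proof.
transitivity (\sum_(i in V) \sum_(Z in slice V p.+1 | i \in Z) phi Z i).
  by apply: eq_bigr => i iV; rewrite (sum_slice_in _ (fun Z => phi Z i)).
rewrite [RHS](exchange_big_dep (mem V)) //=.
by move=> Z i; rewrite !inE => /andP[/fintype.subsetP sZ _] /sZ.
Qed.

Lemma sum_slice_notinl V p (phi : {set T} -> T -> R) :
  \sum_(i in V) \sum_(W in slice (V :\ i) p) phi W i
  = \sum_(W in slice V p) \sum_(i in V :\: W) phi W i.
Proof.
rewrite [RHS](exchange_big_dep (mem V)) /=; last first.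
  by move=> W i _; rewrite !inE => /andP[].
apply: eq_bigr => i iV; rewrite -(sum_slice_notin _ (fun W => phi W i)) //.
by apply: eq_bigl => W; rewrite !inE iV andbT.
Qed.

(** Both sides run over the nested pairs of sets of sizes [p] and [p.+1], enumerated from the lower
    and from the upper set. *)
Lemma sum_slice_add V p (phi : {set T} -> T -> R) :
  \sum_(W in slice V p) \sum_(i in V :\: W) phi (i |: W) i
  = \sum_(Z in slice V p.+1) \sum_(i in Z) phi Z i.
Proof.
by rewrite -sum_slice_addl -(sum_slice_notinl _ _ (fun W i => phi (i |: W) i)).
Qed.

Lemma card_diff_slice V W p : W \in slice V p -> #|V :\: W| = (#|V| - p)%N.
Proof.
by rewrite inE => /andP[sW /eqP cW]; rewrite cardsD (finset.setIidPr sW) cW.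
Qed.

Lemma sum_slice_notin_slot V p (phi : {set T} -> R) :
  \sum_(W in slice V p) \sum_(i in V :\: W) phi W
  = (#|V| - p)%:R * \sum_(W in slice V p) phi W.
Proof.
rewrite mulr_sumr; apply: eq_bigr => W Ws.
by rewrite sumr_const (card_diff_slice Ws) mulr_natl.
Qed.

Lemma sum_slice_in_slot V p (phi : {set T} -> R) :
  \sum_(W in slice V p) \sum_(i in W) phi W
  = p%:R * \sum_(W in slice V p) phi W.
Proof.
rewrite mulr_sumr; apply: eq_bigr => W; rewrite inE => /andP[_ /eqP cW].
by rewrite sumr_const cW mulr_natl.
Qed.

(* The entropy of g under the uniform law on the slice, multiplied by the
   cardinality of the slice. *)
Definition slice_ent V p (g : {set T} -> R) : R :=
  let s := \sum_(Z in slice V p) g Z in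
  \sum_(Z in slice V p) g Z * ln (g Z) - s * ln (s / #|slice V p|%:R).

(* A transposition exchanging a point of Z with a point outside Z is encoded by
   the common part W and the two points, so that the form is symmetric. *)
Definition swap_form V p (D : {set T} -> {set T} -> R) : R :=
  \sum_(W in slice V p) \sum_(i in V :\: W) \sum_(j in V :\: W)
     D (i |: W) (j |: W).

End Slice.

(** * The modified log-Sobolev inequality on a slice *)

Section LogSobolev.
Variables (R : realType) (T : finType).
Implicit Types (V W Z : {set T}) (p : nat) (i j : T) (g : {set T} -> R).

Lemma slice_ent_triv V p g : (#|slice V p| <= 1)%N -> slice_ent V p g = 0.
Proof.
rewrite /slice_ent leq_eqVlt ltnS leqn0 => /orP[|].
  by move=> /cards1P[Z ->]; rewrite !big_set1 cards1 divr1 subrr.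
by rewrite cards_eq0 => /eqP ->; rewrite !big_set0 mul0r subr0.
Qed.

(** By Jensen, the log of the overall mean is at least the mean of the logs; this bounds the entropy
    by the covariance of the value and its logarithm. *)
Lemma ent_two_point (c0 c1 m0 m1 : R) :
  0 < c0 -> 0 < c1 -> 0 < m0 -> 0 < m1 ->
  c0 * m0 * ln m0 + c1 * m1 * ln m1
    - (c0 * m0 + c1 * m1) * ln ((c0 * m0 + c1 * m1) / (c0 + c1))
  <= c0 * c1 / (c0 + c1) * logdist m1 m0.
Proof.
move=> c0p c1p m0p m1p.
set s := _ + _ * m1; set m := s / (c0 + c1).
have cp : 0 < c0 + c1 by lra.
have sp : 0 < s by rewrite /s; nra.
have mp : 0 < m by rewrite divr_gt0.
have key x : 0 < x -> ln x - ln m <= x / m - 1.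
  move=> xp; have := ln_leB1 (divr_gt0 xp mp).
  by rewrite ln_div ?posrE.
have H : c0 * ln m0 + c1 * ln m1 <= (c0 + c1) * ln m.
  have := ler_wpM2l (ltW c0p) (key _ m0p).
  have := ler_wpM2l (ltW c1p) (key _ m1p).
  have E : c1 * (m1 / m - 1) + c0 * (m0 / m - 1) = 0.
    rewrite /m /s; field; apply/andP; split; rewrite gt_eqF //.
  by lra.
have H2 := ler_wpM2l (ltW (divr_gt0 sp cp)) H.
have E2 : s / (c0 + c1) * ((c0 + c1) * ln m) = s * ln m.
  by field; rewrite gt_eqF.
rewrite E2 in H2.
have -> : c0 * c1 / (c0 + c1) * logdist m1 m0 =
  c0 * m0 * ln m0 + c1 * m1 * ln m1
  - s / (c0 + c1) * (c0 * ln m0 + c1 * ln m1).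
  by rewrite /logdist /s; field; rewrite gt_eqF.
by lra.
Qed.

(** Chain rule for the entropy, conditioning on whether [i] belongs to the set. The entropy of the
    two fibre means is bounded by [ent_two_point], and then by [logdist_sum] through the coupling of
    [i |: W] with [j |: W]. *)
Lemma slice_ent_split V p i g : i \in V -> (p.+1 < #|V|)%N ->
  (forall Z, 0 < g Z) ->
  slice_ent V p.+1 g <=
    slice_ent (V :\ i) p.+1 g + slice_ent (V :\ i) p (fun W => g (i |: W))
    + #|V|%:R^-1 * \sum_(W in slice (V :\ i) p) \sum_(j in (V :\ i) :\: W)
        logdist (g (i |: W)) (g (j |: W)).
Proof.
move=> iV pV g0.
set n := #|V| in pV *.
have cV : #|V :\ i| = n.-1 by rewrite /n (cardsD1 i V) iV.
rewrite {1}/slice_ent (sum_slice_split _ (fun Z => g Z * ln (g Z)) iV).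
rewrite (sum_slice_split _ g iV) /slice_ent.
set s0 := \sum_(Z in slice (V :\ i) p.+1) g Z.
set s1 := \sum_(W in slice (V :\ i) p) g (i |: W).
rewrite !card_slice cV -/n.
set c0 : R := 'C(n.-1, p.+1)%:R; set c1 : R := 'C(n.-1, p)%:R.
have np : (p.+1 <= n.-1)%N by rewrite -ltnS prednK //; apply: leq_ltn_trans pV.
have n0 : (0 < n)%N by apply: leq_ltn_trans pV.
have cE : 'C(n, p.+1)%:R = c0 + c1 by rewrite -[n in LHS]prednK // binS natrD.
have c0p : 0 < c0 by rewrite ltr0n bin_gt0.
have c1p : 0 < c1 by rewrite ltr0n bin_gt0 ltnW.
have sgt q (f : {set T} -> R) : (q <= n.-1)%N -> (forall Z, 0 < f Z) ->
  0 < \sum_(Z in slice (V :\ i) q) f Z.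
  move=> qn fp.
  have [Z Zs] : exists Z, Z \in slice (V :\ i) q.
    by apply/set0Pn; rewrite -card_gt0 card_slice cV bin_gt0.
  rewrite (bigD1 Z) //= ltr_pwDl // sumr_ge0 // => ? _; exact: ltW.
have s0p : 0 < s0 by apply: sgt.
have s1p : 0 < s1 by apply: sgt => //; exact: ltnW.
have nR : 0 < n%:R :> R by rewrite ltr0n.
have npR : 0 < (n.-1 - p)%:R :> R by rewrite ltr0n subn_gt0.
have pR : 0 < p.+1%:R :> R by rewrite ltr0n.
set k : R := (n.-1 - p)%:R in npR *; set l : R := p.+1%:R in pR *.
have lkE : l * c0 = k * c1 by rewrite /l /k /c0 /c1 -!natrM mul_bin_left.
have nE : n%:R = k + l.
  by rewrite -natrD; congr (_%:R); move: np n0; clear; lia.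
have H := @ent_two_point c0 c1 (s0 / c0) (s1 / c1) c0p c1p
  (divr_gt0 s0p c0p) (divr_gt0 s1p c1p).
have e0 : c0 * (s0 / c0) = s0 by field; rewrite gt_eqF.
have e1 : c1 * (s1 / c1) = s1 by field; rewrite gt_eqF.
rewrite e0 e1 in H.
suff H2 : c0 * c1 / (c0 + c1) * logdist (s1 / c1) (s0 / c0) <=
   n%:R^-1 * \sum_(W in slice (V :\ i) p) \sum_(j in (V :\ i) :\: W)
      logdist (g (i |: W)) (g (j |: W)).
  by rewrite cE; lra.
(* By the binomial identity [lkE], both fibre means become averages over the same [k * c1] pairs
   [(W, j)]. *)
have -> : s1 / c1 = (k * c1)^-1 * (k * s1) by field; rewrite !gt_eqF.
have -> : s0 / c0 = (k * c1)^-1 * (l * s0) by rewrite -lkE; field; rewrite !gt_eqF.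
rewrite logdistZ ?invr_gt0 ?mulr_gt0 // mulrA.
have -> : c0 * c1 / (c0 + c1) / (k * c1) = n%:R^-1.
  have c0E : c0 = k * c1 / l by rewrite -lkE; field; rewrite gt_eqF.
  rewrite nE c0E; field; do ?[apply/andP; split]; rewrite gt_eqF //; nra.
rewrite ler_wpM2l ?invr_ge0 ?(ltW nR) //.
have -> : k * s1 = \sum_(W in slice (V :\ i) p) \sum_(j in (V :\ i) :\: W) g (i |: W).
  by rewrite (sum_slice_notin_slot _ _ (fun W => g (i |: W))) cV.
have -> : l * s0 = \sum_(W in slice (V :\ i) p) \sum_(j in (V :\ i) :\: W) g (j |: W).
  by rewrite (sum_slice_add _ _ (fun Z _ => g Z)) sum_slice_in_slot.
rewrite !pair_big_dep /=.
apply: (@logdist_sum _ _ _ (fun q => g (i |: q.1)) (fun q => g (q.2 |: q.1))) => q _; apply: g0.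
Qed.

(** A pair of distinct points survives the deletion of [i] for all but two choices of [i] in [U];
    the diagonal contributes nothing. *)
Lemma sum_offdiag (U : {set T}) (D : T -> T -> R) :
  (forall a, D a a = 0) ->
  \sum_(i in U) \sum_(a in U :\ i) \sum_(b in U :\ i) D a b
  = (#|U|%:R - 2) * \sum_(a in U) \sum_(b in U) D a b.
Proof.
move=> D0.
transitivity (\sum_(a in U) \sum_(b in U) \sum_(i in U :\ a :\ b) D a b).
  rewrite (exchange_big_dep (mem U)) /=; last first.
    by move=> i a _; rewrite !inE => /andP[].
  apply: eq_bigr => a aU.
  rewrite (exchange_big_dep (mem U)) /=; last first.
    by move=> i b _; rewrite !inE => /andP[].
  apply: eq_bigr => b bU; apply: eq_bigl => i; rewrite !inE aU bU !andbT.
  by rewrite [b == i]eq_sym [a == i]eq_sym; case: (i \in U); rewrite ?andbF //= andbT andbC.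
rewrite mulr_sumr; apply: eq_bigr => a aU.
rewrite mulr_sumr; apply: eq_bigr => b bU.
rewrite sumr_const; have [->|ab] := eqVneq a b; first by rewrite D0 mulr0 mul0rn.
rewrite -[LHS]mulr_natl; congr (_ * _).
have bUa : b \in U :\ a by rewrite !inE eq_sym ab.
have := cardsD1 a U; rewrite aU (cardsD1 b (U :\ a)) bUa => ->.
by rewrite !natrD /=; ring.
Qed.

(** Restriction to the sets avoiding [i]: a swap survives when [i] is outside its common part and
    its two exchanged points. *)
Lemma swap_form_down V p (D : {set T} -> {set T} -> R) :
  (forall Z, D Z Z = 0) -> (p <= #|V|)%N ->
  \sum_(i in V) swap_form (V :\ i) p D = (#|V|%:R - p%:R - 2) * swap_form V p D.
Proof.
move=> D0 pV; rewrite /swap_form.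
have E i W : (V :\ i) :\: W = (V :\: W) :\ i.
  by apply/setP => a; rewrite !inE andbCA.
rewrite (sum_slice_notinl _ _ (fun W i => \sum_(a in (V :\ i) :\: W)
  \sum_(b in (V :\ i) :\: W) D (a |: W) (b |: W))).
rewrite mulr_sumr; apply: eq_bigr => W Ws.
under eq_bigr => i _ do rewrite E.
by rewrite sum_offdiag // (card_diff_slice Ws) natrB.
Qed.

(** Restriction to the sets containing [i]: a common part of size [p.+1] arises once from each of
    its points. *)
Lemma swap_form_link V p (D : {set T} -> {set T} -> R) :
  \sum_(i in V) swap_form (V :\ i) p (fun Z Z' => D (i |: Z) (i |: Z'))
  = p.+1%:R * swap_form V p.+1 D.
Proof.
rewrite /swap_form -sum_slice_in_slot.
rewrite -(sum_slice_addl _ _ (fun Z i => \sum_(a in V :\: Z)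
  \sum_(b in V :\: Z) D (a |: Z) (b |: Z))).
apply: eq_bigr => i iV; apply: eq_bigr => W _.
have -> : (V :\ i) :\: W = V :\: (i |: W).
  by apply/setP => a; rewrite !inE negb_or andbA [(a \notin W) && _]andbC.
by apply: eq_bigr => a _; apply: eq_bigr => b _; rewrite finset.setUCA [in X in D _ X]finset.setUCA.
Qed.

Lemma swap_form_ge0 V p (D : {set T} -> {set T} -> R) :
  (forall Z Z', 0 <= D Z Z') -> 0 <= swap_form V p D.
Proof. by move=> D0; rewrite /swap_form; do 3! (apply: sumr_ge0 => ? _). Qed.

Lemma logdist_ge0 (x y : R) : 0 < x -> 0 < y -> 0 <= logdist x y.
Proof.
move=> x0 y0; rewrite /logdist; have [xy|/ltW yx] := leP x y.
  by rewrite mulr_le0 // subr_le0 // ler_ln ?posrE.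
by rewrite mulr_ge0 // subr_ge0 // ler_ln ?posrE.
Qed.

(** Induction on [N = #|V|], summing the chain rule over [i] in [V]. The fibres avoiding [i] give
    [(N - p - 2) / (N - 1)] times the form, those containing [i] give [p / (N - 1)], the fibre means
    give [1 / N], and [(N - 2) / (N - 1) + 1 / N <= 1]. *)
Theorem slice_log_sobolev V p g : (forall Z, 0 < g Z) ->
  #|V|%:R * slice_ent V p.+1 g <= swap_form V p (fun Z Z' => logdist (g Z) (g Z')).
Proof.
have [n] := ubnP #|V|; elim: n V p g => // n IH V p g Vn g0.
have D0 Z : logdist (g Z) (g Z) = 0 by exact: logdistxx.
have Dp Z Z' : 0 <= logdist (g Z) (g Z') by exact: logdist_ge0.
have [Vp|pV] := leqP #|V| p.+1.
  have -> : slice_ent V p.+1 g = 0.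
    apply: slice_ent_triv; rewrite card_slice.
    by move: Vp; rewrite leq_eqVlt => /orP[/eqP ->|/bin_small ->]; rewrite ?binn.
  by rewrite mulr0; apply: swap_form_ge0.
set S := swap_form _ _ _.
have S0 : 0 <= S by exact: swap_form_ge0.
have n0 : (1 < #|V|)%N by apply: leq_trans pV.
set N : R := #|V|%:R.
have N1 : 1 < N by rewrite ltr1n.
have cV i : i \in V -> #|V :\ i| = #|V|.-1 by move=> iV; rewrite (cardsD1 i V) iV.
have IHi i q h : i \in V -> (forall Z, 0 < h Z) ->
  (N - 1) * slice_ent (V :\ i) q.+1 h <=
  swap_form (V :\ i) q (fun Z Z' => logdist (h Z) (h Z')).
  move=> iV h0; have -> : N - 1 = #|V :\ i|%:R.
    by rewrite cV // /N -{1}(prednK (ltnW n0)) -natr1 addrK.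
  by apply: IH => //; rewrite cV // -ltnS prednK // ltnW.
have step : N * slice_ent V p.+1 g <= \sum_(i in V)
   (slice_ent (V :\ i) p.+1 g + slice_ent (V :\ i) p (fun W => g (i |: W)))
   + N^-1 * S.
  have -> : N * slice_ent V p.+1 g = \sum_(i in V) slice_ent V p.+1 g.
    by rewrite sumr_const mulr_natl.
  have -> : S = \sum_(i in V) \sum_(W in slice (V :\ i) p) \sum_(j in (V :\ i) :\: W)
        logdist (g (i |: W)) (g (j |: W)).
    rewrite (sum_slice_notinl _ _ (fun W i => \sum_(j in (V :\ i) :\: W)
        logdist (g (i |: W)) (g (j |: W)))).
    apply: eq_bigr => W _; apply: eq_bigr => i iU.
    rewrite (bigD1 i) //= D0 add0r; apply: eq_bigl => j.
    by rewrite !inE andbAC -andbA.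
  rewrite mulr_sumr -big_split /=; apply: ler_sum => i iV.
  exact: slice_ent_split.
have down : \sum_(i in V)
   (slice_ent (V :\ i) p.+1 g + slice_ent (V :\ i) p (fun W => g (i |: W)))
   <= (N - 1)^-1 * ((N - 2) * S).
  rewrite ler_pdivlMl ?subr_gt0 // mulr_sumr.
  under eq_bigr do rewrite mulrDr.
  rewrite big_split /=.
  have H1 : \sum_(i in V) (N - 1) * slice_ent (V :\ i) p.+1 g <= (N - p%:R - 2) * S.
    rewrite -swap_form_down //; last by apply: ltnW; exact: ltnW.
    by apply: ler_sum => i iV; apply: IHi.
  have H2 : \sum_(i in V) (N - 1) * slice_ent (V :\ i) p (fun W => g (i |: W))
     <= p%:R * S.
    (* For [p = 0] the fibre through [i] is a single set and has no entropy; otherwise the induction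
       hypothesis applies one level lower. *)
    case: p @S pV S0 step H1 => [|p] S pV S0 step H1.
      rewrite mul0r big1 // => i iV.
      by rewrite slice_ent_triv ?mulr0 // card_slice bin0.
    rewrite -swap_form_link; apply: ler_sum => i iV.
    exact: (IHi i p (fun W => g (i |: W))).
  by lra.
apply: (le_trans step).
apply: (le_trans (lerD down (lexx _))).
rewrite mulrA -mulrDl -[leRHS]mul1r ler_wpM2r //.
have N10 : 0 < N - 1 by lra.
have NV : N^-1 <= (N - 1)^-1 by rewrite lef_pV2 ?posrE; lra.
have E : (N - 1)^-1 * (N - 2) = 1 - (N - 1)^-1 by field; rewrite gt_eqF.
by rewrite E; lra.
Qed.

End LogSobolev.

(** * Herbst's argument *)

Section Herbst.
Variables (R : realType) (T : finType) (S : {set T}) (F : T -> R).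

Lemma is_derive_expR_sum (l : R) :
  is_derive l 1 (fun k => \sum_(Z in S) expR (k * F Z))
    (\sum_(Z in S) F Z * expR (l * F Z)).
Proof.
pose P (f : R -> R) (df : R) := is_derive l (1 : R) f df.
rewrite (_ : (fun k => _) = \sum_(Z in S) (fun k => expR (k * F Z))); last first.
  by apply/funext => k; rewrite fct_sumE.
apply: (big_ind2 P); rewrite /P.
- exact: is_derive_cst.
- by move=> f1 d1 f2 d2 H1 H2; apply: is_deriveD.
move=> Z _; rewrite mulrC.
apply: (@is_derive1_comp _ expR (fun k => k * F Z) l).
have -> : (fun k => k * F Z) = F Z \*: id.
  by apply/funext => k /=; rewrite mulrC.
apply: is_derive_eq (is_deriveZ (F Z) (is_derive_id l 1)) _.
by rewrite -[RHS]mulr1.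
Qed.

Hypothesis S0 : (0 < #|S|)%N.
Hypothesis F0 : forall Z, Z \in S -> 0 <= F Z.

Let c : R := #|S|%:R.
Let m (l : R) : R := \sum_(Z in S) expR (l * F Z).
Let dm (l : R) : R := \sum_(Z in S) F Z * expR (l * F Z).
Let H (l : R) : R := ln (m l / c).

Let c_gt0 : 0 < c. Proof. by rewrite ltr0n. Qed.

Let c_le_m (l : R) : 0 <= l -> c <= m l.
Proof.
move=> l0; rewrite /c -sum1_card natr_sum /m; apply: ler_sum => Z ZS.
by rewrite -[leLHS]expR0 ler_expR mulr_ge0 // F0.
Qed.

Let m_gt0 (l : R) : 0 <= l -> 0 < m l.
Proof. by move=> l0; apply: lt_le_trans (c_le_m l0). Qed.

Let is_derive_H (l : R) : 0 < l -> is_derive l 1 H (dm l / m l).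
Proof.
move=> l0.
have m0 := m_gt0 (ltW l0).
have mc0 : 0 < m l / c by rewrite divr_gt0.
have -> : H = ln (R:=R) \o (c^-1 \*: m).
  by apply/funext => k /=; rewrite /H mulrC.
apply: is_derive_eq (is_derive1_comp (is_derive1_ln _) (is_deriveZ c^-1 (is_derive_expR_sum l))) _.
  by rewrite (_ : (c^-1 \*: m) l = m l / c) // mulrC.
rewrite (_ : (c^-1 \*: m) l = m l / c); last exact: mulrC.
rewrite -/(dm l) (_ : c^-1 *: dm l = c^-1 * dm l) //.
by field; rewrite !gt_eqF.
Qed.

Variables (a b : R).
Hypothesis a0 : 0 < a.
Hypothesis entF : forall l, 0 < l ->
  l * dm l - m l * H l <= l ^+ 2 * (a * dm l + b * m l).

(** [H] is the log-Laplace transform of [F]. Divided by [l ^+ 2 * m l], the hypothesis [entF] reads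
    [(H / l)' <= a * H' + b], that is [K' <= b]. *)
Let K (l : R) : R := (l^-1 - a) * H l.
Let dK (l : R) : R := (l^-1 - a) * (dm l / m l) - l ^- 2 * H l.

Let is_derive_K (l : R) : 0 < l -> is_derive l 1 K (dK l).
Proof.
move=> l0.
have V : is_derive l 1 (fun k : R => k^-1) (- l ^- 2 *: (1:R)).
  by apply: is_deriveV; rewrite ?gt_eqF.
have C : is_derive l 1 (fun=> a) (0:R) by exact: is_derive_cst.
have -> : K = (((fun k : R => k^-1) - (fun=> a)) * H)%R by [].
apply: is_derive_eq (is_deriveM (is_deriveB V C) (is_derive_H l0)) _.
rewrite (_ : ((fun k : R => k^-1) - (fun=> a)) l = l^-1 - a) //.
rewrite (_ : _ *: _ + _ *: _ =
  (l^-1 - a) * (dm l / m l) + H l * (- l ^- 2 * 1 - 0)) //.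
by rewrite /dK; ring.
Qed.

Let dK_le (l : R) : 0 < l -> dK l <= b.
Proof.
move=> l0; have m0 := m_gt0 (ltW l0).
have lm : 0 < l ^+ 2 * m l by rewrite mulr_gt0 // exprn_gt0.
rewrite -(ler_pM2l lm).
have -> : l ^+ 2 * m l * dK l = (l * dm l - m l * H l) - l ^+ 2 * a * dm l.
  by rewrite /dK; field; rewrite !gt_eqF.
by have := entF l0; lra.
Qed.

Let K_mono (x y : R) : 0 < x -> x <= y -> K y - K x <= b * (y - x).
Proof.
move=> x0 xy.
have pos z : x <= z -> 0 < z by exact: lt_le_trans.
have der z : z \in `]x, y[ -> is_derive z 1 K (dK z).
  by rewrite in_itv /= => /andP[/ltW xz _]; apply: is_derive_K; exact: pos.
have dble z : z \in `[x, y] -> derivable K z 1.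
  by rewrite in_itv /= => /andP[xz _]; case: (is_derive_K (pos _ xz)).
have [z zxy ->] := MVT_segment xy der (derivable_within_continuous dble).
rewrite ler_wpM2r ?subr_ge0 // dK_le //.
by move: zxy; rewrite in_itv /= => /andP[/(lt_le_trans x0)].
Qed.

(** Near 0 the function [K] is at most the mean of [F] up to a linear error. As [l^-1] is singular
    at 0, the integration has to start at a positive point. *)
Let K_small : exists Q : R, 0 < Q /\
  forall x : R, 0 < x -> x * Q <= 1 -> K x <= (\sum_(Z in S) F Z) / c + x * Q.
Proof.
pose s := \sum_(Z in S) F Z; pose q := \sum_(Z in S) F Z ^+ 2.
have s0 : 0 <= s by apply: sumr_ge0.
have q0 : 0 <= q by apply: sumr_ge0 => Z _; exact: sqr_ge0.
(* The term [2 * s] forces [x * F Z <= 1 / 2], where [expR t <= 1 + t + 2 * t ^+ 2]; [2 * q / c] is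
   the second-order term, and 1 makes the constant positive. *)
exists (2 * s + 2 * q / c + 1).
have qc : 0 <= q / c by rewrite divr_ge0 // ltW.
split=> [|x x0 xQ]; first lra.
have xs : x * s <= 1 / 2 by nra.
have Fs Z : Z \in S -> F Z <= s.
  move=> ZS; rewrite /s (bigD1 Z) //= lerDl sumr_ge0 // => Z' /andP[Z'S _].
  exact: F0.
have mx : m x <= c + x * s + x ^+ 2 * (2 * q).
  rewrite /c -sum1_card natr_sum /m /s /q mulr_sumr mulr_sumr mulr_sumr -!big_split /=.
  apply: ler_sum => Z ZS.
  set t := x * F Z.
  have t0 : 0 <= t by rewrite mulr_ge0 ?F0 // ltW.
  have t1 : t <= 1 / 2 by apply: le_trans xs; rewrite ler_wpM2l ?Fs // ltW.
  have et : 1 - t <= expR (- t) by have := expR_ge1Dx (- t); lra.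
  have e0 := expR_gt0 t.
  have : expR t * (1 - t) <= 1.
    by apply: le_trans (ler_wpM2l (ltW e0) et) _; rewrite expRxMexpNx_1.
  have -> : 1%:R + t + x ^+ 2 * (2 * F Z ^+ 2) = 1 + t + 2 * t ^+ 2 :> R.
    by rewrite /t; ring.
  by move=> ?; nra.
have H0 : 0 <= H x.
  by apply: ln_ge0; rewrite ler_pdivlMr // mul1r c_le_m // ltW.
have Hx : H x <= m x / c - 1.
  by apply: ln_leB1; rewrite divr_gt0 // m_gt0 // ltW.
have Hx2 : H x <= x * (s / c) + x ^+ 2 * (2 * q / c).
  apply: (le_trans Hx).
  have -> : x * (s / c) + x ^+ 2 * (2 * q / c) = (c + x * s + x ^+ 2 * (2 * q)) / c - 1.
    by field; rewrite gt_eqF.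
  by rewrite lerD2r ler_pM2r ?invr_gt0.
apply: (@le_trans _ _ (x^-1 * H x)).
  by rewrite /K; apply: ler_wpM2r => //; rewrite gerBl ltW.
rewrite mulrC ler_pdivrMr //.
apply: (le_trans Hx2).
rewrite -/s; have : 0 <= x ^+ 2 * (2 * s + 1) by nra.
by lra.
Qed.

(** At [l = (2 * a)^-1] the factor [l^-1 - a] equals [a], so [K = a * H] there; [K' <= b] is
    integrated from [0+] up to this point. *)
Lemma herbst : ln (m (2 * a)^-1 / c) <= (\sum_(Z in S) F Z) / (a * c) + b / (2 * a ^+ 2).
Proof.
set y := (2 * a)^-1.
have y0 : 0 < y by rewrite invr_gt0 mulr_gt0.
have [Q [Q0 HQ]] := K_small.
have Ky : K y = a * H y by rewrite /K /y invrK; ring.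
suff E : K y <= (\sum_(Z in S) F Z) / c + b * y.
  rewrite -(ler_pM2l a0) -/(H y) -Ky.
  apply: (le_trans E); rewrite le_eqVlt; apply/orP; left; apply/eqP.
  by rewrite /y; field; rewrite !gt_eqF.
apply/ler_addgt0Pr => e e0.
have bQ : 0 < Q + `|b| by have := normr_ge0 b; lra.
(* A starting point so close to 0 that the errors [x * Q] and [x * |b|] add up to at most [e]. *)
pose x := Num.min y (Num.min Q^-1 (e / (Q + `|b|))).
have x0 : 0 < x by rewrite !lt_min y0 invr_gt0 Q0 divr_gt0.
have xy : x <= y by rewrite ge_min lexx.
have xQ : x * Q <= 1.
  by rewrite -ler_pdivlMr // mul1r /x !ge_min lexx orbT.
have xe : x * (Q + `|b|) <= e.
  by rewrite -ler_pdivlMr // /x !ge_min lexx !orbT.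
have := K_mono x0 xy; have := HQ _ x0 xQ.
have : - b * x <= `|b| * x by rewrite ler_wpM2r ?(ltW x0) // -normrN ler_norm.
by lra.
Qed.

End Herbst.

(** * Concentration of penalized suprema *)

Section Concentration.
Variables (R : realType) (T J : finType).
Variables (h : J -> T -> R) (mu : J -> R) (P : pred J) (b v k : R) (p : nat).
Hypothesis b0 : 0 <= b.
Hypothesis v0 : 0 <= v.
Hypothesis k0 : 0 < k.
Hypothesis hb : forall j i, P j -> `|h j i| <= b.
Hypothesis hv : forall j, P j -> \sum_i h j i ^+ 2 <= #|T|%:R * v.
Hypothesis pT : (p.+1 <= #|T|)%N.

Definition penalized_dev (j : J) (Z : {set T}) : R :=
  `|\sum_(i in Z) (h j i - mu j)| + k * \sum_(i in Z) h j i ^+ 2.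

(* The quadratic penalty makes the supremum self-bounding: its maximizer h has
   [k * \sum_(i in Z) h i ^+ 2] at most the supremum, which controls the
   variance proxy. *)
Definition sup_dev (Z : {set T}) : R := \big[Num.max/0]_(j | P j) penalized_dev j Z.

Lemma le_sup_dev j Z : P j -> penalized_dev j Z <= sup_dev Z.
Proof. by move=> Pj; exact: (@le_bigmax_cond _ _ _ _ _ P (fun i => penalized_dev i Z)). Qed.

Lemma sup_devP Z :
  sup_dev Z = 0 \/ exists2 j, P j & sup_dev Z = penalized_dev j Z.
Proof.
apply: (big_ind (fun x => x = 0 \/ exists2 j, P j & x = penalized_dev j Z)).
- by left.
- by move=> x y Hx Hy; case: (leP x y).
by move=> j Pj; right; exists j.
Qed.

Lemma sum_sqr_ge0 j (Z : {set T}) : 0 <= \sum_(i in Z) h j i ^+ 2.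
Proof. by apply: sumr_ge0 => i _; exact: sqr_ge0. Qed.

Lemma sup_dev_ge0 Z : 0 <= sup_dev Z.
Proof.
case: (sup_devP Z) => [->//|[j Pj ->]].
by rewrite addr_ge0 // mulr_ge0 ?sum_sqr_ge0 // ltW.
Qed.

Let L : R := 1 + 2 * k * b.

Let L_ge1 : 1 <= L.
Proof. by rewrite /L lerDl !mulr_ge0 // ltW. Qed.

(** The linear part contributes the 1 in [L], and the penalty contributes [2 * k * b] by factoring
    the difference of squares. *)
Lemma penalized_dev_swap j (W : {set T}) i i' : P j -> i \notin W -> i' \notin W ->
  penalized_dev j (i |: W) - penalized_dev j (i' |: W) <= L * `|h j i - h j i'|.
Proof.
move=> Pj iW i'W; rewrite /penalized_dev !big_setU1 //=.
set s := \sum_(i in W) _; set q := \sum_(i in W) _.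
have H1 : `|h j i - mu j + s| <= `|h j i' - mu j + s| + `|h j i - h j i'|.
  by rewrite -[leLHS]opprK opprK (le_trans _ (ler_normD _ _)) // le_eqVlt; apply/orP; left;
     apply/eqP; congr `|_|; ring.
have H2 : h j i ^+ 2 - h j i' ^+ 2 <= 2 * b * `|h j i - h j i'|.
  apply: le_trans (ler_norm _) _; rewrite subr_sqr normrM mulrC ler_wpM2r //.
  by apply: le_trans (ler_normD _ _) _; have := hb i Pj; have := hb i' Pj; lra.
have := ler_wpM2l (ltW k0) H2; rewrite /L; lra.
Qed.

Let pos (x : R) : R := Num.max x 0.

(** A maximizer at [Z] still competes after the swap, so the drop is at most [L * |h j i - h j i'|].
    After squaring, the penalty bounds the sum of squares over [Z] by [sup_dev Z / k], and [hv]
    bounds the sum over all [i']. *)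
Lemma sup_dev_swap_sum (Z : {set T}) :
  \sum_(i in Z) \sum_(i' in [set: T]%SET :\: (Z :\ i))
      pos (sup_dev Z - sup_dev (i' |: (Z :\ i))) ^+ 2
  <= 2 * L ^+ 2 * #|T|%:R * (sup_dev Z / k + #|Z|%:R * v).
Proof.
have T0 : 0 <= #|T|%:R :> R by [].
have L0 : 0 <= 2 * L ^+ 2 by rewrite mulr_ge0 // sqr_ge0.
(* If the maximum is its default value 0, nothing can drop, since [sup_dev] is nonnegative. *)
case: (sup_devP Z) => [E|[j Pj E]].
  rewrite big1 => [|i _].
    by rewrite E mul0r add0r; do ?apply: mulr_ge0 => //; exact: sqr_ge0.
  rewrite big1 // => i' _; rewrite E.
  by rewrite /pos max_r ?expr0n // sub0r oppr_le0 sup_dev_ge0.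
have Hs : \sum_(i in Z) h j i ^+ 2 <= sup_dev Z / k.
  by rewrite ler_pdivlMr // mulrC E /penalized_dev lerDr.
apply: (@le_trans _ _ (\sum_(i in Z) \sum_i' 2 * L ^+ 2 * (h j i ^+ 2 + h j i' ^+ 2))).
  apply: ler_sum => i iZ; rewrite [leRHS](bigID (mem ([set: T]%SET :\: (Z :\ i)))) /=.
  rewrite -[leLHS]addr0 lerD //; last first.
    by apply: sumr_ge0 => i' _; rewrite mulr_ge0 // addr_ge0 ?sqr_ge0.
  apply: ler_sum => i'; rewrite inE => /andP[i'W _].
  have iW : i \notin Z :\ i by rewrite !inE eqxx.
  have H := penalized_dev_swap Pj iW i'W; rewrite finset.setD1K // -E in H.
  have H' := le_sup_dev (i' |: Z :\ i) Pj.
  have H2 : pos (sup_dev Z - sup_dev (i' |: Z :\ i)) <= L * `|h j i - h j i'|.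
    rewrite /pos ge_max; apply/andP; split; first by lra.
    by rewrite mulr_ge0 // (le_trans _ L_ge1).
  have H3 : 0 <= pos (sup_dev Z - sup_dev (i' |: Z :\ i)) by rewrite le_max lexx orbT.
  have := lerXn2r 2 H3 (le_trans H3 H2 : _ \in Num.nneg) H2.
  move=> /le_trans; apply.
  rewrite exprMn real_normK ?num_real //.
  have H4 : (h j i - h j i') ^+ 2 <= 2 * (h j i ^+ 2 + h j i' ^+ 2).
    by have := sqr_ge0 (h j i + h j i'); lra.
  by have := ler_wpM2l (sqr_ge0 L) H4; lra.
have -> : \sum_(i in Z) \sum_i' 2 * L ^+ 2 * (h j i ^+ 2 + h j i' ^+ 2) =
  2 * L ^+ 2 * (#|T|%:R * \sum_(i in Z) h j i ^+ 2 + #|Z|%:R * \sum_i h j i ^+ 2).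
  have -> : #|Z|%:R * \sum_i h j i ^+ 2 = \sum_(i in Z) \sum_i' h j i' ^+ 2.
    by rewrite sumr_const mulr_natl.
  rewrite [X in _ = _ * (X + _)]mulr_sumr -big_split [RHS]mulr_sumr /=.
  apply: eq_bigr => i _.
  by rewrite -mulr_sumr big_split /= sumr_const [#|T|%:R * _]mulr_natl.
rewrite -[leRHS]mulrA; apply: ler_wpM2l => //; rewrite mulrDr; apply: lerD.
  exact: ler_wpM2l.
by rewrite mulrCA; apply: ler_wpM2l => //; exact: hv.
Qed.

(** Convexity of the exponential. Only drops from the larger value appear, and these are what
    [sup_dev_swap_sum] controls. *)
Lemma logdist_expR_le (l x y : R) : 0 <= l ->
  logdist (expR (l * x)) (expR (l * y)) <=
  l ^+ 2 * (pos (x - y) ^+ 2 * expR (l * x)) +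
  l ^+ 2 * (pos (y - x) ^+ 2 * expR (l * y)).
Proof.
move=> l0; wlog yx : x y / y <= x.
  move=> H; have [/H//|/ltW/H] := leP y x.
  by rewrite logdist_sym addrC.
rewrite /pos (max_l (_ : 0 <= x - y)) ?subr_ge0 // (max_r (_ : y - x <= 0)) ?subr_le0 //.
rewrite expr0n /= mul0r mulr0 addr0 /logdist !expRK -mulrBr.
have e0 := expR_gt0 (l * x).
have : expR (l * y) >= expR (l * x) * (1 + (l * y - l * x)).
  have -> : expR (l * y) = expR (l * x) * expR (l * y - l * x).
    by rewrite -expRD; congr expR; ring.
  by rewrite ler_wpM2l ?expR_ge1Dx // ltW.
have : 0 <= l * (x - y) by rewrite mulr_ge0 ?subr_ge0.
move=> H1 H2.
have H3 : expR (l * x) - expR (l * y) <= expR (l * x) * (l * (x - y)) by lra.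
by have := ler_wpM2r H1 H3; lra.
Qed.

Let a : R := 4 * L ^+ 2 / k.
Let S : {set {set T}} := slice [set: T]%SET p.+1.

Lemma sup_dev_ent (l : R) : 0 < l ->
  l * (\sum_(Z in S) sup_dev Z * expR (l * sup_dev Z))
  - (\sum_(Z in S) expR (l * sup_dev Z)) *
    ln ((\sum_(Z in S) expR (l * sup_dev Z)) / #|S|%:R)
  <= l ^+ 2 * (a * (\sum_(Z in S) sup_dev Z * expR (l * sup_dev Z))
               + (k * p.+1%:R * v * a) * (\sum_(Z in S) expR (l * sup_dev Z))).
Proof.
move=> l0.
have n0 : 0 < #|T|%:R :> R by rewrite ltr0n (leq_trans _ pT).
pose g Z := expR (l * sup_dev Z).
have g0 Z : 0 < g Z by exact: expR_gt0.
have := slice_log_sobolev [set: T]%SET p g0.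
rewrite cardsT /slice_ent -/S => H.
have -> : l * (\sum_(Z in S) sup_dev Z * expR (l * sup_dev Z)) = \sum_(Z in S) g Z * ln (g Z).
  by rewrite mulr_sumr; apply: eq_bigr => Z _; rewrite /g expRK; ring.
rewrite -(ler_pM2l n0); apply: (le_trans H).
pose phi Z i : R := expR (l * sup_dev Z) * \sum_(i' in [set: T]%SET :\: (Z :\ i))
   pos (sup_dev Z - sup_dev (i' |: (Z :\ i))) ^+ 2.
(* Exchanging the two swapped points identifies the two one-sided sums, whence the factor 2. *)
apply: (@le_trans _ _ (2 * l ^+ 2 * \sum_(Z in S) \sum_(i in Z) phi Z i)).
  rewrite -sum_slice_add.
  have E W : W \in slice [set: T]%SET p -> \sum_(i in [set: T]%SET :\: W) phi (i |: W) i =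
     \sum_(i in [set: T]%SET :\: W) \sum_(i' in [set: T]%SET :\: W)
       pos (sup_dev (i |: W) - sup_dev (i' |: W)) ^+ 2 * expR (l * sup_dev (i |: W)).
    move=> _; apply: eq_bigr => i; rewrite inE => /andP[iW _].
    by rewrite /phi finset.setU1K // mulrC mulr_suml.
  rewrite (eq_bigr _ E) mulr_sumr; apply: ler_sum => W _.
  set U := _ :\: W.
  have -> : 2 * l ^+ 2 * \sum_(i in U) \sum_(i' in U)
       pos (sup_dev (i |: W) - sup_dev (i' |: W)) ^+ 2 * expR (l * sup_dev (i |: W)) =
     \sum_(i in U) \sum_(i' in U) (l ^+ 2 * (pos (sup_dev (i |: W) - sup_dev (i' |: W)) ^+ 2
          * expR (l * sup_dev (i |: W))))
     + \sum_(i in U) \sum_(i' in U) (l ^+ 2 * (pos (sup_dev (i' |: W) - sup_dev (i |: W)) ^+ 2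
          * expR (l * sup_dev (i' |: W)))).
    rewrite [X in _ = _ + X]exchange_big /= -mulrA mulr_natl mulr2n mulr_sumr.
    by congr (_ + _); apply: eq_bigr => i _; rewrite mulr_sumr.
  rewrite -big_split; apply: ler_sum => i _; rewrite -big_split; apply: ler_sum => i' _.
  by rewrite /g; apply: logdist_expR_le; exact: ltW.
have l2 : 0 <= 2 * l ^+ 2 by rewrite mulr_ge0 // sqr_ge0.
apply: (@le_trans _ _ (2 * l ^+ 2 * \sum_(Z in S) expR (l * sup_dev Z) *
   (2 * L ^+ 2 * #|T|%:R * (sup_dev Z / k + p.+1%:R * v)))).
  rewrite ler_wpM2l //; apply: ler_sum => Z ZS.
  rewrite -mulr_sumr; apply: ler_wpM2l; first exact: expR_ge0.
  by move: ZS (sup_dev_swap_sum Z); rewrite inE => /andP[_ /eqP ->].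
rewrite !(mulr_sumr, =^~ big_split) /= le_eqVlt; apply/orP; left; apply/eqP.
apply: eq_bigr => Z _; rewrite /a; field; exact: lt0r_neq0.
Qed.

(** Markov's inequality for [expR (l * sup_dev Z)] at [l = (2 * a)^-1]; the threshold exceeds the
    bound of [herbst] by exactly [x] in the exponent. *)
Lemma sup_dev_concentration (x : R) :
  #|[set Z in S | 2 * ((\sum_(Z in S) sup_dev Z) / #|S|%:R) + k * p.+1%:R * v
                  + 2 * a * x < sup_dev Z]|%:R
  <= #|S|%:R * expR (- x).
Proof.
have S0 : (0 < #|S|)%N by rewrite card_slice cardsT bin_gt0.
have SR : 0 < #|S|%:R :> R by rewrite ltr0n.
have L1 := L_ge1.
have a0 : 0 < a by rewrite /a divr_gt0 // mulr_gt0 // exprn_gt0 // (lt_le_trans _ L1).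
have := herbst S0 (fun Z _ => sup_dev_ge0 Z) a0 sup_dev_ent.
set E := \sum_(Z in S) sup_dev Z; set c := k * _ * v.
set m := \sum_(Z in S) _ => H.
set t := 2 * _ + _ + _; set A := [set Z in S | _].
have m0 : 0 < m.
  have [Z ZS] : exists Z, Z \in S by apply/set0Pn; rewrite -card_gt0.
  rewrite /m (bigD1 Z) //= ltr_pwDl ?expR_gt0 // sumr_ge0 // => ? _; exact: expR_ge0.
have markov : #|A|%:R * expR ((2 * a)^-1 * t) <= m.
  rewrite mulr_natl -sumr_const /m [leRHS](bigID (mem A)) /=.
  rewrite -[leLHS]addr0; apply: lerD; last by apply: sumr_ge0 => ? _; exact: expR_ge0.
  rewrite [leRHS](eq_bigl (mem A)) /=; last first.
    by move=> Z; rewrite !inE andbA andbb.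
  apply: ler_sum => Z; rewrite inE => /andP[_ /ltW tZ].
  by rewrite ler_expR; apply: ler_wpM2l => //; rewrite invr_ge0 mulr_ge0 // ltW.
have mle : m <= #|S|%:R * expR (E / (a * #|S|%:R) + c * a / (2 * a ^+ 2)).
  rewrite mulrC -ler_pdivrMr //.
  rewrite -[leLHS]lnK ?posrE ?divr_gt0 // ler_expR.
  exact: H.
have e0 := expR_gt0 ((2 * a)^-1 * t).
rewrite -(ler_pM2r e0); apply: (le_trans markov); apply: (le_trans mle).
rewrite -[leRHS]mulrA ler_wpM2l // -expRD ler_expR le_eqVlt; apply/orP; left; apply/eqP.
rewrite /t; field; rewrite !gt_eqF //.
Qed.

End Concentration.

Local Open Scope classical_set_scope.
Local Open Scope ring_scope.

(** * Deviations of a finite family *)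

Lemma splitsE n p : splits n p = slice [set: 'I_n]%SET p.
Proof. by apply/setP => Z; rewrite !inE finset.subsetT. Qed.

Lemma splits_setC (u m : nat) (Z : {set 'I_(u + m)}) :
  (~: Z \in splits (u + m) m)%SET = (Z \in splits (u + m) u).
Proof.
by rewrite !inE cardsCs finset.setCK card_ord; have := max_card Z; rewrite card_ord; lia.
Qed.

Section Families.
Variables (R : realType).

Lemma sum_splits_setC (u m : nat) (G : {set 'I_(u + m)} -> R) :
  \sum_(Z in splits (u + m) u) G (~: Z)%SET = \sum_(Z in splits (u + m) m) G Z.
Proof.
rewrite [RHS](reindex_inj (inv_inj (@finset.setCK _))) /=.
by apply: eq_bigl => Z; rewrite splits_setC.
Qed.

Lemma card_splits n p : #|splits n p| = 'C(n, p).
Proof. by rewrite splitsE card_slice cardsT card_ord. Qed.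

Lemma split_esp_setC (u m : nat) (G : {set 'I_(u + m)} -> R) :
  split_esp u (fun Z : {set 'I_(u + m)} => G (~: Z)%SET) = split_esp m G.
Proof.
rewrite /split_esp sum_splits_setC !card_splits; congr (_ / _%:R).
by rewrite -{3}(addKn u m) bin_sub ?leq_addr.
Qed.

(** Complementation carries the uniform law on [u]-subsets to that on [m]-subsets, so one deviation
    bound serves both averages. *)
Lemma complexity_trainE (u m : nat) eta (A : set ('I_(u + m) -> R)) :
  complexity_train u eta A = complexity_test m eta A.
Proof.
exact: (@split_esp_setC u m (fun Z => sup [set (-1) ^+ eta * (avg h Z - avg_full h) | h in A])).
Qed.

Lemma avg_fullE n (h : 'I_n -> R) : avg_full h = (\sum_i h i) / n%:R.
Proof.
rewrite /avg_full /avg cardsT card_ord; congr (_ / _).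
by apply: eq_bigl => i; rewrite finset.in_setT.
Qed.

Lemma normr_avg_le n (h : 'I_n -> R) (Z : {set 'I_n}) b : 0 <= b ->
  (forall i, `|h i| <= b) -> `|avg h Z| <= b.
Proof.
move=> b0 hb; rewrite /avg; have [->|Z0] := eqVneq Z finset.set0.
  by rewrite big_set0 mul0r normr0.
have cZ : 0 < #|Z|%:R :> R by rewrite ltr0n card_gt0.
rewrite normrM normfV (ger0_norm (ltW cZ)) ler_pdivrMr //.
apply: le_trans (ler_norm_sum _ _ _) _.
rewrite mulr_natr -sumr_const; exact: ler_sum.
Qed.

(** Rules out the default value 0 of the real [sup] on sets unbounded above. *)
Lemma deviation_ubound n (A : set ('I_n -> R)) (Z : {set 'I_n}) (eta : bool) b :
  0 <= b -> (forall h, A h -> forall i, `|h i| <= b) ->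
  has_ubound [set (-1) ^+ eta * (avg h Z - avg_full h) | h in A].
Proof.
move=> b0 Ab; exists (2 * b) => _ [h Ah <-].
apply: le_trans (ler_norm _) _; rewrite normrM normrX normrN1 expr1n mul1r.
apply: le_trans (ler_normB _ _) _.
have := normr_avg_le Z b0 (Ab _ Ah); have := normr_avg_le [set: 'I_n]%SET b0 (Ab _ Ah).
by rewrite /avg_full; lra.
Qed.

Lemma deviation_le_sup n (A : set ('I_n -> R)) (Z : {set 'I_n}) (eta : bool) b h :
  0 <= b -> (forall h, A h -> forall i, `|h i| <= b) -> A h ->
  (-1) ^+ eta * (avg h Z - avg_full h)
    <= sup [set (-1) ^+ eta * (avg h Z - avg_full h) | h in A].
Proof.
move=> b0 Ab Ah; apply: ub_le_sup; first exact: deviation_ubound Ab.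
by exists h.
Qed.

Lemma avg0 n (Z : {set 'I_n}) : avg (fun=> 0 : R) Z = 0.
Proof. by rewrite /avg big1 // mul0r. Qed.

Lemma sup_deviation_ge0 n (A : set ('I_n -> R)) (Z : {set 'I_n}) (eta : bool) b :
  0 <= b -> (forall h, A h -> forall i, `|h i| <= b) -> A (fun=> 0) ->
  0 <= sup [set (-1) ^+ eta * (avg h Z - avg_full h) | h in A].
Proof.
move=> b0 Ab A0; apply: le_trans (deviation_le_sup Z eta b0 Ab A0).
by rewrite /avg_full !avg0 subrr mulr0.
Qed.

Variables (n : nat) (J : finType) (h : J -> 'I_n -> R) (P : pred J).
Variables (A : set ('I_n -> R)) (b v k w : R) (p : nat).
Hypothesis b0 : 0 <= b.
Hypothesis v0 : 0 <= v.
Hypothesis k0 : 0 < k.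
Hypothesis Ab : forall g, A g -> forall i, `|g i| <= b.
Hypothesis hA : forall j, P j -> A (h j).
Hypothesis hv : forall j, P j -> second_moment (h j) <= v.
Hypothesis p_gt0 : (0 < p)%N.
Hypothesis pn : (p <= n)%N.
Hypothesis Aw : forall eta, complexity_test p eta (adjoin0 A) <= w.
Hypothesis A2w : complexity_test p false (adjoin0_squares A) <= w.

Let mu j := avg_full (h j).

Let n0 : 0 < n%:R :> R.
Proof. by rewrite ltr0n (leq_trans _ pn). Qed.

Let adj_b g : adjoin0 A g -> forall i, `|g i| <= b.
Proof. by case=> [/Ab//|->] i; rewrite normr0. Qed.

Let adj2_b g : adjoin0_squares A g -> forall i, `|g i| <= b ^+ 2.
Proof.
case=> [[f /Ab Af <-]|->] i; last by rewrite normr0 sqr_ge0.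
by rewrite normrX lerXn2r // ?nnegrE // Af.
Qed.

Let adj0 : adjoin0 A (fun=> 0). Proof. by right. Qed.
Let adj20 : adjoin0_squares A (fun=> 0). Proof. by right. Qed.

Lemma sum_second_moment j : P j -> \sum_i h j i ^+ 2 <= #|'I_n|%:R * v.
Proof.
move=> Pj; have := hv Pj; rewrite /second_moment card_ord -ler_pdivrMl //.
Qed.

Let sp (eta : bool) (Z : {set 'I_n}) :=
  sup [set (-1) ^+ eta * (avg h Z - avg_full h) | h in adjoin0 A].
Let sp2 (Z : {set 'I_n}) :=
  sup [set (-1) ^+ false * (avg h Z - avg_full h) | h in adjoin0_squares A].

Lemma avg_dev j (Z : {set 'I_n}) : #|Z| = p ->
  \sum_(i in Z) (h j i - mu j) = p%:R * (avg (h j) Z - mu j).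
Proof.
move=> cZ; rewrite big_split /= sumr_const cZ /avg cZ mulNrn -mulr_natl.
by field; rewrite gt_eqF // ltr0n.
Qed.

(** With 0 adjoined, both one-sided suprema are nonnegative, so their sum dominates the absolute
    deviation. The penalty is at most the supremum over the squares plus the second moment bound
    [v]. *)
Lemma sup_dev_le Z : Z \in splits n p ->
  sup_dev h mu P k Z
    <= p%:R * (sp false Z + sp true Z + k * sp2 Z + k * v).
Proof.
rewrite inE => /eqP cZ.
have b20 : 0 <= b ^+ 2 by exact: sqr_ge0.
have p0 : 0 < p%:R :> R by rewrite ltr0n.
have s1 := sup_deviation_ge0 Z false b0 adj_b adj0; rewrite -/(sp false Z) in s1.
have s2 := sup_deviation_ge0 Z true b0 adj_b adj0; rewrite -/(sp true Z) in s2.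
have s3 := sup_deviation_ge0 Z false b20 adj2_b adj20; rewrite -/(sp2 Z) in s3.
case: (sup_devP h mu P k Z) => [->|[j Pj ->]].
  by rewrite mulr_ge0 ?addr_ge0 ?mulr_ge0 // ltW.
rewrite /penalized_dev avg_dev // normrM (ger0_norm (ltW p0)).
have -> : \sum_(i in Z) h j i ^+ 2 = p%:R * avg (fun i => h j i ^+ 2) Z.
  by rewrite /avg cZ; field; rewrite gt_eqF.
rewrite mulrCA -mulrDr ler_wpM2l ?(ltW p0) //.
have Aj : adjoin0 A (h j) by left; exact: hA.
have A2j : adjoin0_squares A (fun i => h j i ^+ 2) by left; exists (h j); [exact: hA|].
have d1 := deviation_le_sup Z false b0 adj_b Aj.
have d2 := deviation_le_sup Z true b0 adj_b Aj.
have d3 := deviation_le_sup Z false b20 adj2_b A2j.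
rewrite -/(sp _ _) expr0 mul1r -/(mu j) in d1.
rewrite -/(sp _ _) expr1 mulN1r -/(mu j) in d2.
rewrite -/(sp2 _) expr0 mul1r in d3.
have H1 : `|avg (h j) Z - mu j| <= sp false Z + sp true Z.
  by rewrite ler_norml; apply/andP; split; lra.
have H2 : avg_full (fun i => h j i ^+ 2) <= v.
  by have := hv Pj; rewrite avg_fullE mulrC.
have H3 : avg (fun i => h j i ^+ 2) Z <= sp2 Z + v by lra.
have := ler_wpM2l (ltW k0) H3; lra.
Qed.

Lemma mean_sup_dev_le :
  (\sum_(Z in splits n p) sup_dev h mu P k Z) / #|splits n p|%:R
  <= p%:R * (2 * w + k * w + k * v).
Proof.
have S0 : 0 < #|splits n p|%:R :> R by rewrite ltr0n card_splits bin_gt0.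
have p0 : 0 < p%:R :> R by rewrite ltr0n.
apply: (@le_trans _ _ (p%:R * (split_esp p (sp false) + split_esp p (sp true)
   + k * split_esp p sp2 + k * v))); last first.
  rewrite ler_wpM2l ?(ltW p0) // lerD2r.
  have := Aw false; have := Aw true; have := ler_wpM2l (ltW k0) A2w.
  rewrite /complexity_test -/sp -/sp2; lra.
rewrite ler_pdivrMr // /split_esp.
set c := #|splits n p|%:R in S0 *.
apply: (@le_trans _ _ (\sum_(Z in splits n p)
   p%:R * (sp false Z + sp true Z + k * sp2 Z + k * v))).
  by apply: ler_sum => Z; exact: sup_dev_le.
rewrite -mulr_sumr !big_split /= -mulr_sumr sumr_const -[_ *+ _]mulr_natl -/c.
by rewrite le_eqVlt; apply/orP; left; apply/eqP; field; rewrite gt_eqF.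
Qed.

Lemma deviation_concentration (x : R) :
  #|[set Z in splits n p | ~~ [forall j, P j ==>
      (`|avg (h j) Z - avg_full (h j)| <=
         2 * (2 * w + k * w + k * v) + k * v
         + 2 * (4 * (1 + 2 * k * b) ^+ 2 / k) * (x / p%:R))]]|%:R
  <= #|splits n p|%:R * expR (- x).
Proof.
(* The concentration bound concerns slices of size [p.+1], hence it is used at [p.-1]. *)
have pn' : (p.-1.+1 <= #|'I_n|)%N by rewrite card_ord prednK.
have p0 : 0 < p%:R :> R by rewrite ltr0n.
have hb j i : P j -> `|h j i| <= b by move=> /hA /Ab.
have := sup_dev_concentration mu b0 v0 k0 hb sum_second_moment pn' x.
rewrite prednK // -splitsE; apply: le_trans; rewrite ler_nat; apply: subset_leq_card.
apply/fintype.subsetP => Z; rewrite !inE => /andP[cZ].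
rewrite cZ /= => /forallPn[j]; rewrite negb_imply -ltNge => /andP[Pj Hj].
have Zs : Z \in splits n p by rewrite inE.
apply: lt_le_trans (le_sup_dev h mu k Z Pj).
apply: (@lt_le_trans _ _ `|\sum_(i in Z) (h j i - mu j)|); last first.
  by rewrite lerDl; apply: mulr_ge0; [exact: ltW|exact: sum_sqr_ge0].
rewrite avg_dev; last exact/eqP.
rewrite normrM (ger0_norm (ltW p0)).
apply: (@le_lt_trans _ _ (p%:R * (2 * (2 * w + k * w + k * v) + k * v
         + 2 * (4 * (1 + 2 * k * b) ^+ 2 / k) * (x / p%:R)))); last first.
  by rewrite ltr_pM2l.
have E : p%:R * (2 * (4 * (1 + 2 * k * b) ^+ 2 / k) * (x / p%:R))
   = 2 * (4 * (1 + 2 * k * b) ^+ 2 / k) * x.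
  by field; rewrite !gt_eqF.
rewrite mulrDr E; have := mean_sup_dev_le; lra.
Qed.

End Families.

(** Weighted by [u] and [m], the two deviations cancel, so the one on the complement is [- u / m]
    times the one on [Z]. *)
Lemma avg_setC_dev (R : realType) n (h : 'I_n -> R) (Z : {set 'I_n}) (u m : nat) :
  #|Z| = u -> #|(~: Z)%SET| = m -> (0 < u)%N -> (u <= m)%N ->
  `|avg h (~: Z)%SET - avg_full h| <= `|avg h Z - avg_full h|.
Proof.
move=> cZ cC u0 um; have := cardsC Z; rewrite card_ord cZ cC => nE.
have m0 : (0 < m)%N by exact: leq_trans um.
have uR : 0 < u%:R :> R by rewrite ltr0n.
have mR : 0 < m%:R :> R by rewrite ltr0n.
have umR : u%:R <= m%:R :> R by rewrite ler_nat.
have nR : n%:R = u%:R + m%:R :> R by rewrite -natrD nE.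
rewrite avg_fullE /avg cZ cC nR (bigID (mem Z) xpredT) /=.
have -> : \sum_(i in (~: Z)%SET) h i = \sum_(i | i \notin Z) h i.
  by apply: eq_bigl => i; rewrite inE.
set s := \sum_(i in Z) _; set t := \sum_(i | _) _.
have -> : t / m%:R - (s + t) / (u%:R + m%:R) =
    - (u%:R / m%:R) * (s / u%:R - (s + t) / (u%:R + m%:R)).
  by field; rewrite !gt_eqF ?addr_gt0.
rewrite normrM -[leRHS]mul1r ler_wpM2r // normrN ger0_norm ?divr_ge0 //.
by rewrite ler_pdivrMr // mul1r.
Qed.

(** * Simultaneous deviations on both sides of a split *)

Definition uniform_dev (R : realType) (n : nat) (J : finType) (h : J -> 'I_n -> R)
    (P : pred J) (d : R) (Z : {set 'I_n}) : bool :=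
  [forall j, P j ==> (`|avg (h j) Z - avg_full (h j)| <= d)
                     && (`|avg (h j) (~: Z)%SET - avg_full (h j)| <= d)].

Section TwoSided.
Variables (R : realType) (u m : nat) (J : finType) (h : J -> 'I_(u + m) -> R) (P : pred J).
Variables (A : set ('I_(u + m) -> R)) (b v k w x : R).
Hypothesis u0 : (0 < u)%N.
Hypothesis m0 : (0 < m)%N.
Hypothesis b0 : 0 <= b.
Hypothesis v0 : 0 <= v.
Hypothesis k0 : 0 < k.
Hypothesis Ab : forall g, A g -> forall i, `|g i| <= b.
Hypothesis hA : forall j, P j -> A (h j).
Hypothesis hv : forall j, P j -> second_moment (h j) <= v.
Hypothesis Aw : max_complexity u (adjoin0 A) (adjoin0_squares A) <= w.

Let d : R := 2 * (2 * w + k * w + k * v) + k * v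
         + 2 * (4 * (1 + 2 * k * b) ^+ 2 / k) * (x / (minn u m)%:R).

Lemma uniform_dev_concentration :
  #|[set Z in splits (u + m) u | ~~ uniform_dev h P d Z]|%:R
  <= #|splits (u + m) u|%:R * expR (- x).
Proof.
have [Au At] : (forall eta, complexity_test u eta (adjoin0 A) <= w) /\
   (forall eta, complexity_test m eta (adjoin0 A) <= w).
  move: Aw; rewrite /max_complexity /= !ge_max -!andbA !complexity_trainE.
  by case/and5P=> ? ? ? ? /and4P[? ? ? ?]; split; case.
have [A2u A2t] : complexity_test u false (adjoin0_squares A) <= w /\
   complexity_test m false (adjoin0_squares A) <= w.
  move: Aw; rewrite /max_complexity /= !ge_max -!andbA !complexity_trainE.
  by case/and5P=> ? ? ? ? /and4P[? ? ? ?].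
have [um|/ltnW mu] := leqP u m.
  have := deviation_concentration b0 v0 k0 Ab hA hv u0 (leq_addr m u) Au A2u x.
  apply: le_trans.
  rewrite ler_nat; apply: subset_leq_card; apply/fintype.subsetP => Z.
  rewrite !inE => /andP[/eqP cZ]; rewrite cZ eqxx /=; apply: contra => /forallP H.
  apply/forallP => j; apply/implyP => Pj; have := H j; rewrite Pj /= => Hj.
  have Hd : `|avg (h j) Z - avg_full (h j)| <= d by rewrite /d (minn_idPl um).
  have cC : #|(~: Z)%SET| = m by have := cardsC Z; rewrite card_ord cZ; lia.
  by rewrite Hd; apply: le_trans Hd; exact: avg_setC_dev cZ cC u0 um.
(* Now the complement is the smaller side: the bound is applied to [m]-subsets and the bad event is
   carried back by complementation. *)
have := deviation_concentration b0 v0 k0 Ab hA hv m0 (leq_addl u m) At A2t x.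
have -> : #|splits (u + m) m| = #|splits (u + m) u|.
  by rewrite !card_splits -{2}(addKn u m) bin_sub ?leq_addr.
apply: le_trans; rewrite ler_nat -(card_imset _ (inv_inj (@finset.setCK _))).
apply: subset_leq_card; apply/fintype.subsetP => _ /imsetP[Z + ->].
rewrite inE => /andP[Zs]; rewrite inE splits_setC Zs /=; apply: contra => /forallP H.
have cC : #|(~: Z)%SET| = m by move: Zs; rewrite -splits_setC inE => /eqP.
apply/forallP => j; apply/implyP => Pj; have := H j; rewrite Pj /= => Hj.
have Hd : `|avg (h j) (~: Z)%SET - avg_full (h j)| <= d by rewrite /d (minn_idPr mu).
rewrite Hd andbT; apply: le_trans Hd; rewrite -{1}[Z]finset.setCK.
have cZ : #|Z| = u by move: Zs; rewrite inE => /eqP.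
by apply: (avg_setC_dev _ cC _ m0 mu); rewrite finset.setCK.
Qed.

End TwoSided.

(** * Localization by shells *)

Lemma uniform_dev_le (R : realType) (n : nat) (J : finType) (h : J -> 'I_n -> R)
    (P : pred J) (d d' : R) (Z : {set 'I_n}) :
  d <= d' -> uniform_dev h P d Z -> uniform_dev h P d' Z.
Proof.
move=> dd' /forallP H; apply/forallP => j; apply/implyP => Pj.
have /andP[H1 H2] := implyP (H j) Pj.
by rewrite (le_trans H1 dd') (le_trans H2 dd').
Qed.

Lemma geometric_sum_le (R : realType) (q : R) (n : nat) :
  0 <= q -> 3 * q <= 1 -> \sum_(k < n) q ^+ k.+1 <= 3 * q.
Proof.
move=> q0 q3.
(* The remainder makes the induction work; the constant reflects [1 / (1 - q) <= 3 / 2]. *)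
suff H : \sum_(k < n) q ^+ k.+1 <= 3 / 2 * q - 3 / 2 * q ^+ n.+1.
  by have : 0 <= q ^+ n.+1 by [rewrite exprn_ge0]; lra.
elim: n => [|n IH]; first by rewrite big_ord0 expr1; lra.
rewrite big_ord_recr /= [q ^+ n.+2]exprSr.
have : 0 <= q ^+ n.+1 by rewrite exprn_ge0.
nra.
Qed.

Lemma card_union_bound (R : realType) (T : finType) (S : {set T}) (K : nat)
    (g : 'I_K -> pred T) (e : 'I_K -> R) :
  (forall k, #|[set Z in S | ~~ g k Z]%SET|%:R <= #|S|%:R * e k) ->
  #|[set Z in S | ~~ [forall k, g k Z]]%SET|%:R <= #|S|%:R * \sum_k e k.
Proof.
move=> H.
apply: (@le_trans _ _ (\sum_k #|[set Z in S | ~~ g k Z]%SET|%:R)); last first.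
  by rewrite mulr_sumr; apply: ler_sum => k _; exact: H.
rewrite -natr_sum ler_nat.
have E (p : pred T) : #|[set Z in S | p Z]%SET| = (\sum_(Z in S) p Z)%N.
  rewrite -sum1_card big_mkcond [RHS]big_mkcond; apply: eq_bigr => Z _.
  by rewrite inE; case: (Z \in S); case: (p Z).
rewrite E.
have -> : (\sum_k #|[set Z in S | ~~ g k Z]%SET| = \sum_k \sum_(Z in S) ~~ g k Z)%N.
  by apply: eq_bigr => k _; exact: E.
rewrite exchange_big; apply: leq_sum => Z _.
case: (boolP [forall k, g k Z]) => //= /forallPn[k gk].
by rewrite (bigD1 k) //= gk.
Qed.

(* The weight of the quadratic penalty, the resulting sub-exponential scale, and
   the factor between the smallest shell radius and [rho + t / N], chosen so that
   on each shell of radius r the deviations are at most r / (8 B). *)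
Definition penalty (R : realType) (B : R) : R := Num.min 1 (72 * B)^-1.
Definition scale (R : realType) (B b : R) : R :=
  4 * (1 + 2 * penalty B * b) ^+ 2 / penalty B.
Definition loc_factor (R : realType) (B b : R) : R :=
  1 + 144 * B + 48 * scale B b * B.

Section Localization.
Variables (R : realType) (u m : nat) (J : finType) (h : J -> 'I_(u + m) -> R).
Variables (A : R -> set ('I_(u + m) -> R)) (B b rho t : R).
Hypothesis u0 : (0 < u)%N.
Hypothesis m0 : (0 < m)%N.
Hypothesis B0 : 0 < B.
Hypothesis b0 : 0 < b.
Hypothesis rho0 : 0 < rho.
Hypothesis t0 : 0 < t.
Hypothesis Ab : forall r g, A r g -> forall i, `|g i| <= b.
Hypothesis hA : forall j r, B * avg_full (h j) <= r -> A r (h j).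
Hypothesis hB : forall j, second_moment (h j) <= B * avg_full (h j).
Hypothesis Arho : forall r, rho <= r ->
  max_complexity u (adjoin0 (A r)) (adjoin0_squares (A r)) <= Num.sqrt (r * rho).

Let s : R := t / (minn u m)%:R.
Let D : R := loc_factor B b.
Definition shell (k : nat) : R := 4 ^+ k * (loc_factor B b ^+ 2 * (rho + t / (minn u m)%:R)).
Let pen : R := penalty B.

Let pen0 : 0 < pen.
Proof. by rewrite lt_min ltr01 invr_gt0 mulr_gt0. Qed.
Let pen1 : pen <= 1. Proof. by rewrite ge_min lexx. Qed.
Let penB : pen * (72 * B) <= 1.
Proof.
have B72 : 0 < 72 * B by rewrite mulr_gt0.
by rewrite -ler_pdivlMr // mul1r /pen ge_min lexx orbT.
Qed.
Let scale0 : 0 < scale B b.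
Proof.
rewrite divr_gt0 // mulr_gt0 // exprn_gt0 //.
by rewrite addr_gt0 // !mulr_gt0.
Qed.
Let sB : 0 < 48 * scale B b * B. Proof. by apply: mulr_gt0 => //; apply: mulr_gt0. Qed.
Let D1 : 1 <= D. Proof. rewrite /D /loc_factor; have := sB; have := B0; lra. Qed.
Let D0 : 0 < D. Proof. exact: lt_le_trans D1. Qed.
Let s0 : 0 < s.
Proof. by rewrite divr_gt0 // ltr0n leq_min u0 m0. Qed.

Lemma shell_gt0 k : 0 < shell k.
Proof. by rewrite mulr_gt0 ?exprn_gt0 // mulr_gt0 ?exprn_gt0 // addr_gt0. Qed.

Let X0 k : 1 <= 4 ^+ k :> R. Proof. by rewrite exprn_ege1 // ler1n. Qed.

Let shell_rho k : D ^+ 2 * rho <= shell k.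
Proof.
rewrite /shell -/D -/s -[leLHS]mul1r; apply: ler_pM => //.
  by rewrite mulr_ge0 ?(ltW rho0) // sqr_ge0.
by rewrite ler_wpM2l ?exprn_ge0 ?(ltW D0) // lerDl (ltW s0).
Qed.

(** Since [4 ^+ k] dominates [k.+1], shell [k] can afford the confidence level [k.+1 * t]; the
    failure probabilities then form a geometric series. *)
Let shell_s k : D ^+ 2 * (k.+1%:R * s) <= shell k.
Proof.
have H : k.+1%:R <= 4 ^+ k :> R by rewrite -natrX ler_nat ltn_expl.
rewrite /shell -/D -/s [leLHS]mulrCA; apply: ler_pM => //.
  by rewrite mulr_ge0 ?(ltW s0) // sqr_ge0.
by rewrite ler_wpM2l ?exprn_ge0 ?(ltW D0) // lerDr (ltW rho0).
Qed.

Definition in_shell k : pred J := fun j => B * avg_full (h j) <= shell k.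

Lemma shell_concentration k :
  #|[set Z in splits (u + m) u | ~~ uniform_dev h (in_shell k) (shell k / (8 * B)) Z]%SET|%:R
  <= #|splits (u + m) u|%:R * expR (- t) ^+ k.+1.
Proof.
have r0 := shell_gt0 k; set r := shell k in r0 *.
have rho_r : rho <= r.
  apply: le_trans (shell_rho k); rewrite -[leLHS]mul1r ler_wpM2r ?(ltW rho0) //.
  by rewrite exprn_ege1.
(* As [r] is at least [D ^+ 2 * rho], the bound [Num.sqrt (r * rho)] is at most [r / D]. *)
have Aw : max_complexity u (adjoin0 (A r)) (adjoin0_squares (A r)) <= r / D.
  apply: le_trans (Arho rho_r) _.
  have rD : 0 <= r / D by rewrite divr_ge0 // ltW.
  rewrite -[leRHS](ger0_norm rD) -sqrtr_sqr; apply: ler_wsqrtr.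
  have -> : (r / D) ^+ 2 = r * (r / D ^+ 2) by field; rewrite gt_eqF.
  apply: ler_wpM2l; first exact: ltW.
  by rewrite ler_pdivlMr ?exprn_gt0 // mulrC shell_rho.
have hv j : in_shell k j -> second_moment (h j) <= r by move=> /(le_trans (hB j)).
have hAr j : in_shell k j -> A r (h j) by exact: hA.
have := uniform_dev_concentration (k.+1%:R * t) u0 m0 (ltW b0) (ltW r0) pen0 (@Ab r) hAr hv Aw.
rewrite -mulrN mulr_natl expRM_natl; apply: le_trans.
rewrite ler_nat; apply: subset_leq_card; apply/fintype.subsetP => Z.
rewrite !inE => /andP[-> /=]; apply: contra; apply: uniform_dev_le.
rewrite -/(scale B b) -[_ * t / _]mulrA -/s.
have B24 : 0 < 24 * B by rewrite mulr_gt0.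
(* The complexity, penalty and confidence terms each get a third of the budget [r / (8 * B)]. *)
have e1 : r / D * 6 <= r / (24 * B).
  rewrite -mulrA ler_wpM2l ?(ltW r0) // mulrC ler_pdivrMr // ler_pdivlMl //.
  by rewrite /D /loc_factor; have := sB; have := B0; lra.
have e2 : 3 * (pen * r) <= r / (24 * B).
  rewrite ler_pdivlMr //.
  have := ler_wpM2r (ltW r0) penB; lra.
have e3 : 2 * scale B b * (k.+1%:R * s) <= r / (24 * B).
  rewrite ler_pdivlMr //.
  apply: le_trans (shell_s k).
  have -> : 2 * scale B b * (k.+1%:R * s) * (24 * B) = (48 * scale B b * B) * (k.+1%:R * s).
    by ring.
  apply: ler_wpM2r; first by rewrite mulr_ge0 // ltW.
  apply: (@le_trans _ _ D); first by rewrite /D /loc_factor; have := B0; lra.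
  by rewrite expr2 -[leLHS]mulr1 ler_wpM2l // ltW.
have e4 : pen * (r / D) <= r / D.
  by rewrite -[leRHS]mul1r ler_wpM2r // divr_ge0 // ltW.
have -> : r / (8 * B) = r / (24 * B) + r / (24 * B) + r / (24 * B).
  by field; rewrite gt_eqF.
by lra.
Qed.

Definition good_split (K : nat) (Z : {set 'I_(u + m)}) : bool :=
  [forall k : 'I_K.+1, uniform_dev h (in_shell k) (shell k / (8 * B)) Z].

Lemma good_split_prob (K : nat) :
  #|[set Z in splits (u + m) u | ~~ good_split K Z]%SET|%:R
  <= #|splits (u + m) u|%:R * (3 * expR (- t)).
Proof.
(* If [3 * expR (- t)] is at least 1 the bound is trivial; otherwise the geometric series may be
   summed. *)
have [big|small] := leP 1 (3 * expR (- t)).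
  rewrite -[leLHS]mulr1 ler_pM // ler_nat; apply: subset_leq_card.
  by apply/fintype.subsetP => Z; rewrite inE => /andP[].
apply: le_trans (_ : _ <= #|splits (u + m) u|%:R * \sum_(k < K.+1) expR (- t) ^+ k.+1) _.
  by apply: card_union_bound => k; exact: shell_concentration.
by rewrite ler_wpM2l // geometric_sum_le ?expR_ge0 // ltW.
Qed.

(** A nonpositive average on one side bounds the full average by the deviation. In shell [k.+1] this
    gives [B * avg_full (h j) <= shell k.+1 / 8 = shell k / 2], so the function falls into shell
    [k], and so on down to shell 0. *)
Lemma good_split_localizes (K : nat) (Z : {set 'I_(u + m)}) j :
  good_split K Z -> in_shell K j ->
  (avg (h j) Z <= 0) || (avg (h j) (~: Z)%SET <= 0) ->
  in_shell 0 j.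
Proof.
move=> /forallP G jK neg.
suff H i : (i <= K)%N -> in_shell (K - i) j by rewrite -(subnn K); exact: H.
elim: i => [|i IH] iK; first by rewrite subn0.
set k := (K - i.+1)%N.
have ek : (K - i)%N = k.+1 by rewrite /k; clear -iK; lia.
have jk : in_shell k.+1 j by rewrite -ek; exact: IH (ltnW iK).
have kK : (k.+1 < K.+1)%N by rewrite /k; clear -iK; lia.
have /andP[d1 d2] := implyP (forallP (G (Ordinal kK)) j) jk.
rewrite /= in d1 d2.
have B8 : 0 < 8 * B by rewrite mulr_gt0.
have H : avg_full (h j) <= shell k.+1 / (8 * B).
  by case/orP: neg => ?; [move: d1|move: d2]; rewrite ler_norml => /andP[]; lra.
rewrite ler_pdivlMr // in H.
have E : shell k.+1 = 4 * shell k by rewrite /shell exprS -mulrA.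
have := shell_gt0 k; rewrite /in_shell; lra.
Qed.

End Localization.

(** * Excess risk *)

(** Monotonicity of [psi r / Num.sqrt r] from the fixed point on, where the ratio is
    [Num.sqrt r0]. *)
Lemma sub_root_le_sqrt (R : realType) (psi : R -> R) (r0 r : R) :
  sub_root psi -> pos_fixed_point psi r0 -> r0 <= r -> psi r <= Num.sqrt (r * r0).
Proof.
move=> [_ _ H] [r00 fix0] r0r.
have r_gt0 : 0 < r by exact: lt_le_trans r0r.
have sr : 0 < Num.sqrt r by rewrite sqrtr_gt0.
have := H _ _ r00 r0r; rewrite fix0 ler_pdivrMr // => /le_trans; apply.
rewrite sqrtrM ?(ltW r_gt0) // mulrC ler_wpM2l ?sqrtr_ge0 //.
rewrite ler_pdivrMr ?sqrtr_gt0 // -expr2 sqr_sqrtr //; exact: ltW.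
Qed.

Lemma avgB (R : realType) n (g1 g2 : 'I_n -> R) (Z : {set 'I_n}) :
  avg (g1 \- g2) Z = avg g1 Z - avg g2 Z.
Proof. by rewrite /avg -mulrBl -sumrB. Qed.

Section ExcessRisk.
Variables (R : realType) (TX TY : Type) (u m : nat).
Variables (x : 'I_(u + m) -> TX) (y : 'I_(u + m) -> TY).
Variables (F : set (TX -> R)) (loss : R -> TY -> R) (L0 B : R) (fs : TX -> R).
Variables (fm fu : {set 'I_(u + m)} -> TX -> R).
Hypothesis u0 : (0 < u)%N.
Hypothesis m0 : (0 < m)%N.
Hypothesis L00 : 0 < L0.
Hypothesis loss_bd : forall f i, F f -> 0 <= sample_loss loss x y f i <= L0.
Hypothesis Ffs : F fs.
Hypothesis fs_min : avg_full (sample_loss loss x y fs)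
      = inf [set avg_full (sample_loss loss x y f) | f in F].
Hypothesis B0 : 0 < B.
Hypothesis bernstein : forall h, Delta_star loss x y F fs h ->
  second_moment h <= B * avg_full h.
Hypothesis fmP : forall Z, Z \in splits (u + m) u ->
  argmin F (fun f => avg (sample_loss loss x y f) (~: Z)%SET) (fm Z).
Hypothesis fuP : forall Z, Z \in splits (u + m) u ->
  argmin F (fun f => avg (sample_loss loss x y f) Z) (fu Z).

Lemma Delta_bounded g : Delta loss x y F g -> forall i, `|g i| <= L0.
Proof.
move=> [f1 F1 [f2 F2 <-]] i /=.
have /andP[a1 b1] := loss_bd i F1; have /andP[a2 b2] := loss_bd i F2.
by rewrite ler_norml; apply/andP; split; lra.
Qed.

Lemma Delta_star_Delta g : Delta_star loss x y F fs g -> Delta loss x y F g.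
Proof. by move=> [f Ff <-]; exists f => //; exists fs. Qed.

Lemma avg_full_excess_ge0 f : F f -> 0 <= avg_full (excess_loss loss x y fs f).
Proof.
move=> Ff; rewrite /avg_full avgB subr_ge0 -!/(avg_full _) fs_min.
apply: ge_inf; last by exists f.
exists 0 => _ [g Fg <-]; rewrite avg_fullE divr_ge0 // sumr_ge0 // => i _.
by case/andP: (loss_bd i Fg).
Qed.

(** The pair [(f, fs)] is admissible in the infimum, and [fs] has zero excess. *)
Lemma surrogate_Delta_star_le g : Delta_star loss x y F fs g ->
  surrogate loss x y F fs B g <= 2 * B * avg_full g.
Proof.
move=> [f Ff <-]; apply: ge_inf.
  exists 0 => _ [f1 [f2 [F1 F2 _ ->]]].
  by rewrite mulr_ge0 ?addr_ge0 ?avg_full_excess_ge0 // mulr_ge0 // ltW.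
exists f, fs; split => //.
by rewrite [avg_full (excess_loss _ _ _ fs fs)]avgB subrr addr0.
Qed.

Let J : finType := ({set 'I_(u + m)} * bool)%type.

(** A finite family containing both minimizers of every split; [true] selects the training one. The
    fallback [fs] keeps indices that are not splits inside [Delta_star]. *)
Definition erm_excess (j : J) : 'I_(u + m) -> R :=
  excess_loss loss x y fs
    (if j.1 \in splits (u + m) u then if j.2 then fm j.1 else fu j.1 else fs).

Lemma erm_excess_Delta_star j : Delta_star loss x y F fs (erm_excess j).
Proof.
rewrite /erm_excess; case: ifP => Zs; last by exists fs.
by case: ifP => _; [exists (fm j.1) => //; case: (fmP Zs)
                   |exists (fu j.1) => //; case: (fuP Zs)].
Qed.

Lemma avg_full_erm_excess_ge0 j : 0 <= avg_full (erm_excess j).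
Proof. by have [f Ff <-] := erm_excess_Delta_star j; exact: avg_full_excess_ge0. Qed.

(** Stated for abstract balls [A] so as to cover both localizations. On the good event both
    minimizers lie in shell 0, and the excess risk is at most one full average plus two deviations,
    [(1 + 1/8 + 1/8) * sh 0 / B]. *)
Lemma localized_excess_risk (A : R -> set ('I_(u + m) -> R)) (rho t : R) :
  0 < rho -> 0 < t ->
  (forall r g, A r g -> Delta loss x y F g) ->
  (forall g r, Delta_star loss x y F fs g -> B * avg_full g <= r -> A r g) ->
  (forall r, rho <= r ->
    max_complexity u (adjoin0 (A r)) (adjoin0_squares (A r)) <= Num.sqrt (r * rho)) ->
  1 - 3 * expR (- t) <=
  split_prob R u (fun Z : {set 'I_(u + m)} =>
    excess_risk loss x y Z (fu Z) (fm Z)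
      <= 2 * loc_factor B L0 ^+ 2 / B * (rho + t / (minn u m)%:R)).
Proof.
move=> rho0 t0 AD AS Arho.
have Ab r g : A r g -> forall i, `|g i| <= L0 by move=> /AD; exact: Delta_bounded.
have hA j r : B * avg_full (erm_excess j) <= r -> A r (erm_excess j).
  by apply: AS; exact: erm_excess_Delta_star.
have hB j : second_moment (erm_excess j) <= B * avg_full (erm_excess j).
  by apply: bernstein; exact: erm_excess_Delta_star.
set sh := @shell R u m B L0 rho t.
have sh0 := shell_gt0 u0 m0 B0 L00 rho0 t0 0; rewrite -/sh in sh0.
(* The outermost shell contains every function bounded by [L0]. *)
have [K HK] : exists K, B * L0 <= sh K.
  exists (Num.bound (B * L0 / sh 0%N)).
  set K := Num.bound _.
  have -> : sh K = 4 ^+ K * sh 0%N by rewrite /sh /shell expr0 mul1r.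
  rewrite -ler_pdivrMr //.
  have q0 : 0 <= B * L0 / sh 0%N by rewrite ltW // divr_gt0 // mulr_gt0.
  apply: (le_trans (ltW (archi_boundP q0))).
  by rewrite -natrX ler_nat ltnW // ltn_expl.
have allK j : in_shell erm_excess B L0 rho t K j.
  rewrite /in_shell -/sh; apply: le_trans HK; rewrite ler_pM2l //.
  apply: le_trans (ler_norm _) _; apply: normr_avg_le; first exact: ltW.
  by move=> i; apply: Delta_bounded; apply: Delta_star_Delta; exact: erm_excess_Delta_star.
have bad := good_split_prob u0 m0 B0 L00 rho0 t0 Ab hA hB Arho K.
set G := good_split _ _ _ _ _ K in bad.
have c0 : 0 < #|splits (u + m) u|%:R :> R by rewrite ltr0n card_splits bin_gt0 leq_addr.
rewrite /split_prob ler_pdivlMr //.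
set E := fun Z : {set 'I_(u + m)} => _.
have GE Z : Z \in splits (u + m) u -> G Z -> E Z.
  move=> Zs GZ.
  have [Fm minm] := fmP Zs; have [Fu minu] := fuP Zs.
  pose h1 := erm_excess (Z, true); pose h2 := erm_excess (Z, false).
  have E1 : h1 = excess_loss loss x y fs (fm Z) by rewrite /h1 /erm_excess /= Zs.
  have E2 : h2 = excess_loss loss x y fs (fu Z) by rewrite /h2 /erm_excess /= Zs.
  (* Each minimizer does at least as well as [fs] on its own side of the split. *)
  have n1 : avg h1 (~: Z)%SET <= 0 by rewrite E1 avgB subr_le0; exact: minm.
  have n2 : avg h2 Z <= 0 by rewrite E2 avgB subr_le0; exact: minu.
  have l1 : in_shell erm_excess B L0 rho t 0 (Z, true).
    apply: (good_split_localizes u0 m0 B0 L00 rho0 t0 GZ (allK _)).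
    by rewrite n1 orbT.
  have l2 : in_shell erm_excess B L0 rho t 0 (Z, false).
    by apply: (good_split_localizes u0 m0 B0 L00 rho0 t0 GZ (allK _)); rewrite n2.
  have G0 := forallP GZ ord0.
  have /andP[d1 _] := implyP (forallP G0 (Z, true)) l1.
  have /andP[d2 _] := implyP (forallP G0 (Z, false)) l2.
  rewrite /= -/sh -/h1 in d1; rewrite /= -/sh -/h2 in d2.
  rewrite /in_shell -/h1 -/sh mulrC -ler_pdivlMr // in l1.
  have p2 : 0 <= avg_full h2 by exact: avg_full_erm_excess_ge0.
  have ER : excess_risk loss x y Z (fu Z) (fm Z) = avg h1 Z - avg h2 Z.
    by rewrite /excess_risk E1 E2 !avgB; ring.
  rewrite /E Zs ER /=.
  have -> : 2 * loc_factor B L0 ^+ 2 / B * (rho + t / (minn u m)%:R) = 2 * (sh 0%N / B).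
    by rewrite /sh /shell expr0 mul1r; ring.
  move: d1 d2; rewrite !ler_norml => /andP[_ d1] /andP[d2 _].
  have e8 : sh 0%N / (8 * B) = (sh 0%N / B) / 8 by field; rewrite gt_eqF.
  rewrite e8 in d1 d2.
  have : 0 < sh 0%N / B by rewrite divr_gt0.
  by lra.
have part : (#|splits (u + m) u| <= #|finset E|
    + #|[set Z in splits (u + m) u | ~~ G Z]%SET|)%N.
  rewrite -(cardsID (finset E) (splits (u + m) u)); apply: leq_add.
    exact: subset_leq_card (subsetIr _ _).
  apply: subset_leq_card; apply/fintype.subsetP => Z /setDP[Zs nE].
  by rewrite finset.inE Zs /=; apply: contra nE => GZ; rewrite finset.inE; exact: GE.
rewrite -(ler_nat R) natrD in part.
by lra.
Qed.

End ExcessRisk.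

(** * Choice of the constant and of the localization *)

Theorem mainTheorem3 (R : realType) :
  exists cDelta : R -> R -> R,
    (forall B L0 : R, 0 < B -> 0 < L0 -> 0 < cDelta B L0) /\
    forall (u m d : nat) (X : set 'rV[R]_d) (Y : set R)
      (x : 'I_(u + m) -> set_type X) (y : 'I_(u + m) -> set_type Y)
      (F : set (set_type X -> R)) (loss : R -> set_type Y -> R)
      (L0 B K0 : R) (fs : set_type X -> R)
      (fm fu : {set 'I_(u + m)} -> set_type X -> R)
      (psi psi_star : R -> R) (r_um r_star : R),
    (2 <= u)%N -> (2 <= m)%N ->
    F !=set0 ->
    0 < L0 ->
    (forall f i, F f -> 0 <= sample_loss loss x y f i <= L0) ->
    F fs ->
    avg_full (sample_loss loss x y fs)
      = inf [set avg_full (sample_loss loss x y f) | f in F] ->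
    0 < B ->
    (forall h, Delta_star loss x y F fs h ->
      second_moment h <= B * avg_full h) ->
    (forall Z, Z \in splits (u + m) u ->
      argmin F (fun f => avg (sample_loss loss x y f) (~: Z)%SET) (fm Z)) ->
    (forall Z, Z \in splits (u + m) u ->
      argmin F (fun f => avg (sample_loss loss x y f) Z) (fu Z)) ->
    1 < K0 ->
    sub_root psi -> pos_fixed_point psi r_um ->
    (forall r, r_um <= r ->
      max_complexity u
        (adjoin0 (Delta_ball loss x y F fs B r))
        (adjoin0_squares (Delta_ball loss x y F fs B r)) <= psi r) ->
    sub_root psi_star -> pos_fixed_point psi_star r_star ->
    (forall r, r_star <= r ->
      max_complexity u
        (adjoin0 (Delta_star_ball loss x y F fs B r))
        (adjoin0_squares (Delta_star_ball loss x y F fs B r)) <= psi_star r) ->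
    forall t : R, 0 < t ->
      1 - 3 * expR (- t) <=
      split_prob R u (fun Z : {set 'I_(u + m)} =>
        excess_risk loss x y Z (fu Z) (fm Z) <=
          const_c1 K0 * r_um + 4 * B * cDelta B L0 * r_star / K0
          + const_c3 K0 L0 B (cDelta B L0) * t / (minn u m)%:R).
Proof.
pose C (B L0 : R) := 2 * loc_factor B L0 ^+ 2 / B.
have loc1 (B L0 : R) : 0 < B -> 0 < L0 -> 1 <= loc_factor B L0.
  move=> B0 L00; rewrite /loc_factor.
  have p0 : 0 < penalty B by rewrite lt_min ltr01 invr_gt0 mulr_gt0.
  have : 0 <= 48 * scale B L0 * B.
    rewrite mulr_ge0 ?(ltW B0) // mulr_ge0 // divr_ge0 ?(ltW p0) //.
    by rewrite mulr_ge0 // sqr_ge0.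
  by lra.
have C0 (B L0 : R) : 0 < B -> 0 < L0 -> 0 < C B L0.
  move=> B0 L00; have l0 := lt_le_trans ltr01 (loc1 _ _ B0 L00).
  by apply: divr_gt0 => //; apply: mulr_gt0 => //; exact: exprn_gt0.
(* With this choice [4 * B * cDelta / K0] is [4 * C ^+ 2 / K0]. *)
exists (fun B L0 => C B L0 ^+ 2 / B); split.
  by move=> B L0 B0 L00; rewrite divr_gt0 // exprn_gt0 // C0.
move=> u m d X Y x y F loss L0 B K0 fs fm fu psi psi_star r_um r_star.
move=> u2 m2 _ L00 loss_bd Ffs fs_min B0 bern fmP fuP K01 sr fp cplx sr' fp' cplx' t t0.
have u0 : (0 < u)%N by exact: ltnW.
have m0 : (0 < m)%N by exact: ltnW.
have r0 : 0 < r_um by case: fp.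
have r0' : 0 < r_star by case: fp'.
have CB := C0 _ _ B0 L00; set c := C B L0 in CB *.
have s0 : 0 < t / (minn u m)%:R by rewrite divr_gt0 // ltr0n leq_min u0 m0.
set s := t / _ in s0.
have K0p : 0 < K0 by lra.
have c219 : const_c0 R ^+ 2 = 219 by rewrite /const_c0 sqr_sqrtr.
have c0p : 0 <= const_c0 R by exact: sqrtr_ge0.
have d0p : 4 <= const_d0 R by rewrite /const_d0; lra.
(* The factor 2 pays for the radius [2 * r_um] in the second localization. *)
have H1 : K0 * 2 <= const_c1 K0.
  have d16 : 1 <= const_d0 R ^+ 2 by apply: exprn_ege1; lra.
  have := ler_wpM2l (ltW K0p) d16; rewrite /const_c1; lra.
have H2 : K0 <= const_c2 K0 L0 by rewrite /const_c2 c219; lra.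
have q0 : 0 <= c ^+ 2 / K0 by rewrite divr_ge0 ?sqr_ge0 // ltW.
have bound (rho : R) : c * rho <= const_c1 K0 * r_um + 4 * (c ^+ 2 / K0) * r_star ->
    c <= K0 + 4 * (c ^+ 2 / K0) ->
    c * (rho + s) <= const_c1 K0 * r_um + 4 * B * (c ^+ 2 / B) * r_star / K0
          + const_c3 K0 L0 B (c ^+ 2 / B) * t / (minn u m)%:R.
  move=> Hr Hc.
  have -> : 4 * B * (c ^+ 2 / B) * r_star / K0 = 4 * (c ^+ 2 / K0) * r_star.
    by field; rewrite !gt_eqF.
  have -> : const_c3 K0 L0 B (c ^+ 2 / B) * t / (minn u m)%:R
     = (const_c2 K0 L0 + 4 * (c ^+ 2 / K0)) * s.
    rewrite /const_c3 -mulrA -/s; congr (_ * _); congr (_ + _).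
    by field; rewrite !gt_eqF.
  have := ler_wpM2r (ltW s0) Hc; have := ler_wpM2r (ltW s0) H2; lra.
have weaken (rho M : R) : c * (rho + s) <= M ->
    1 - 3 * expR (- t) <= split_prob R u (fun Z : {set 'I_(u + m)} =>
        excess_risk loss x y Z (fu Z) (fm Z) <= c * (rho + s)) ->
    1 - 3 * expR (- t) <= split_prob R u (fun Z : {set 'I_(u + m)} =>
        excess_risk loss x y Z (fu Z) (fm Z) <= M).
  move=> le /le_trans; apply; rewrite /split_prob ler_wpM2r ?invr_ge0 // ler_nat.
  apply: subset_leq_card; apply/fintype.subsetP => Z; rewrite !inE => /andP[-> /=].
  by move=> /le_trans; apply.
(* If [K0 <= c] then [c <= c ^+ 2 / K0], so the terms with [cDelta] alone absorb [c * (r_star + s)];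
   if [c <= K0], the constants [c1] and [c2] absorb [c * (2 * r_um + s)]. *)
have [Kc|/ltW cK] := leP K0 c.
  have cK0 : c <= c ^+ 2 / K0 by rewrite ler_pdivlMr // expr2 ler_wpM2l // ltW.
  have cst : c <= K0 + 4 * (c ^+ 2 / K0) by lra.
  apply: (weaken r_star) (localized_excess_risk u0 m0 L00 loss_bd Ffs fs_min B0 bern fmP fuP
    (A := Delta_star_ball loss x y F fs B) r0' t0 _ _ _).
  - apply: bound => //.
    have := ler_wpM2r (ltW r0') cK0; have : 0 <= const_c1 K0 * r_um by nra.
    by have : 0 <= c ^+ 2 / K0 * r_star by [nra]; lra.
  - by move=> r g [/(Delta_star_Delta Ffs)].
  - by move=> g r Dg gr; split.
  - by move=> r rr; apply: le_trans (cplx' _ rr) _; exact: sub_root_le_sqrt.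
(* The balls are dilated to radius [2 * r] to match the factor 2 in the surrogate; correspondingly
   [2 * r * r_um = r * (2 * r_um)] under the root. *)
apply: (weaken (2 * r_um)) (localized_excess_risk u0 m0 L00 loss_bd Ffs fs_min B0 bern fmP fuP
    (A := fun r => Delta_ball loss x y F fs B (2 * r)) _ t0 _ _ _).
- apply: bound; last by lra.
  have := ler_wpM2r (ltW r0) H1; have := ler_wpM2r (ltW r0) cK.
  by have : 0 <= c ^+ 2 / K0 * r_star by [rewrite mulr_ge0 // ltW]; lra.
- by rewrite mulr_gt0.
- by move=> r g [].
- move=> g r Dg gr; split; first exact: (Delta_star_Delta Ffs).
  apply: le_trans (surrogate_Delta_star_le loss_bd Ffs fs_min B0 Dg) _.
  by lra.
- move=> r rr; have r2 : r_um <= 2 * r by lra.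
  apply: le_trans (cplx _ r2) _.
  have -> : r * (2 * r_um) = 2 * r * r_um by ring.
  exact: sub_root_le_sqrt.
Qed.
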